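(* Let $R\subset S$ be a catenarian integral FCP extension of rings and let ${}_S^tR$ be the $t$-closure of $R$ in $S$. Then $R\subset S$ is a $\Delta$-extension if and only if both $R\subseteq {}_S^tR$ and ${}_S^tR\subseteq S$ are $\Delta$-extensions. Moreover, the condition that ${}_S^tR\subseteq S$ is a $\Delta$-extension is equivalent to ${}_S^tR\subseteq S$ being arithmetic.
   Context: All rings are commutative and unital. For a ring extension $R\subseteq S$, $[R,S]$ denotes the set of all $R$-subalgebras of $S$, ordered by inclusion. The extension is FCP if every chain in $[R,S]$ is finite. It is a $\Delta$-extension if $T+U\in[R,S]$ for all $T,U\in[R,S]$ (equivalently $T+U=TU$, the compositum). It is catenarian if it is FCP and all maximal chains between two comparable elements of $[R,S]$ have the same length. It is chained if $[R,S]$ is totally ordered by inclusion, and arithmetic if $R_P\subseteq S_P$ is chained for each $P\in\mathrm{Spec}(R)$ (with $S_P:=S_{R\setminus P}$). It is $t$-closed if the relations $b\in S$, $r\in R$, $b^2-rb\in R$, $b^3-rb^2\in R$ imply $b\in R$. An integral extension is infra-integral if for each $Q\in\mathrm{Spec}(S)$, with $P:=Q\cap R$, the residual field extension $\kappa_R(P)\to\kappa_S(Q)$ is an isomorphism. The $t$-closure ${}_S^tR$ of $R$ in $S$ is the smallest $B\in[R,S]$ such that $B\subseteq S$ is $t$-closed; it is also the greatest $B'\in[R,S]$ such that $R\subseteq B'$ is infra-integral. *)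

(* Defs.v *)
From HB Require Import structures.
From mathcomp Require Import all_boot all_order all_algebra generic_quotient.
From mathcomp Require Import ring.
From mathcomp Require Import boolp classical_sets functions cardinality.

Set Implicit Arguments.
Unset Strict Implicit.
Unset Printing Implicit Defensive.

Import GRing.Theory.
Local Open Scope classical_set_scope.
Local Open Scope ring_scope.
Local Open Scope quotient_scope.

(* A ring extension R ⊆ S is represented by two subrings R, S of an ambient   *)
(* commutative ring A (for the top ring, S is the full set [set: A]).         *)

Section Extensions.
Variable A : comPzRingType.
Implicit Types R S T U B P : set A.

Definition is_subring T : Prop := subring_closed [in T].

(* [R, S] *)
Definition interm R S : set (set A) :=
  [set T | [/\ is_subring T, R `<=` T & T `<=` S]].

Definition is_chain (C : set (set A)) : Prop := total_on C subset.

Definition FCP R S : Prop :=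
  forall C, C `<=` interm R S -> is_chain C -> finite_set C.

Definition maximal_chain R S (C : set (set A)) : Prop :=
  [/\ C `<=` interm R S, is_chain C &
      forall C', C' `<=` interm R S -> is_chain C' -> C `<=` C' -> C' = C].

(* A finite chain with n elements has length n - 1, so equality of lengths is *)
(* equality of cardinals.                                                     *)
Definition catenarian R S : Prop :=
  FCP R S /\
  forall T U, interm R S T -> interm R S U -> T `<=` U ->
  forall C C', maximal_chain T U C -> maximal_chain T U C' -> (C #= C')%card.

Definition chained R S : Prop := total_on (interm R S) subset.

Definition Delta_extension R S : Prop :=
  forall T U, interm R S T -> interm R S U ->
  interm R S [set x + y | x in T & y in U].

Definition t_closed R S : Prop :=
  forall b r, S b -> R r ->
  R (b ^+ 2 - r * b) -> R (b ^+ 3 - r * b ^+ 2) -> R b.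

Definition t_closure R S : set A :=
  [set x | S x /\ forall B, interm R S B -> t_closed B S -> B x].

(* The second conjunct of [t_closureP] says that [t_closure R S] is the       *)
(* smallest element of [R, S] over which S is t-closed.                       *)
Lemma t_closureP R S : is_subring R -> is_subring S -> R `<=` S ->
  (interm R S (t_closure R S) /\ t_closed (t_closure R S) S) /\
  forall B, interm R S B -> t_closed B S -> t_closure R S `<=` B.
Proof.
move=> hR hS RS; split; last by move=> B hB tB x [_]; apply.
split; last first.
  move=> b r Sb [_ hr] [_ h2] [_ h3]; split=> // B hB tB.
  by apply: (tB b r); [|exact: hr|exact: h2|exact: h3].
split; last by move=> x [].
- split.
  + rewrite inE; split; first by case: hS; rewrite inE.
    by move=> B [[+ _ _] _ _] _; rewrite inE.
  + move=> x y; rewrite !inE => -[Sx hx] [Sy hy]; split.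
      by have [_ /(_ x y) + _] := hS; rewrite !inE; apply.
    move=> B hB tB; have [[_ /(_ x y) + _] _ _] := hB.
    by rewrite !inE; apply; [exact: hx|exact: hy].
  + move=> x y; rewrite !inE => -[Sx hx] [Sy hy]; split.
      by have [_ _ /(_ x y)] := hS; rewrite !inE; apply.
    move=> B hB tB; have [[_ _ /(_ x y) +] _ _] := hB.
    by rewrite !inE; apply; [exact: hx|exact: hy].
- by move=> x Rx; split; [exact: RS|move=> B [_ RB _] _; exact: RB].
Qed.

(* P is a prime ideal of the subring R *)
Record prime_ideal R P : Prop := PrimeIdeal {
  prime_ideal_subring : is_subring R;
  prime_ideal_sub : P `<=` R;
  prime_ideal0 : P 0;
  prime_idealD : forall x y, P x -> P y -> P (x + y);
  prime_idealM : forall r x, R r -> P x -> P (r * x);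
  prime_ideal1 : ~ P 1;
  prime_ideal_prime : forall x y, R x -> R y -> P (x * y) -> P x \/ P y }.

Record mult_set := MultSet {
  mult_carrier :> set A;
  mult_closed : mulr_closed [in mult_carrier] }.

Lemma prime_compl_closed R P : prime_ideal R P -> mulr_closed [in R `\` P].
Proof.
move=> h; have [R1 _ RM] := prime_ideal_subring h; split.
  by rewrite inE; split; [rewrite inE in R1|exact: prime_ideal1 h].
move=> x y; rewrite !inE => -[Rx Px] [Ry Py]; split.
  by have := RM x y; rewrite !inE; apply.
by move=> /(prime_ideal_prime h Rx Ry) [].
Qed.

Definition prime_compl R P (h : prime_ideal R P) : mult_set :=
  MultSet (prime_compl_closed h).

End Extensions.

Section IntegralExtension.
Variable A : comNzRingType.

Definition integral_extension (R S : set A) : Prop :=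
  forall x, S x ->
  exists p : {poly A}, [/\ p \is monic, p \is a polyOver [in R] & root p x].

End IntegralExtension.

(* Localization of A at a multiplicative set D: fractions a/s with s in D,    *)
(* where a/s = b/t iff u (a t - b s) = 0 for some u in D.                     *)
Module Localization.
Section Localization.
Variables (A : comPzRingType) (D : mult_set A).

Definition denom : Type := {s : A | s \in mult_carrier D}.
HB.instance Definition _ := Choice.on denom.

Definition dval (s : denom) : A := sval s.
Arguments dval : simpl never.

Definition den1 : denom :=
  exist _ 1 (let: conj h _ := mult_closed D in h).

Lemma denM_subproof (s t : denom) : dval s * dval t \in mult_carrier D.
Proof. by have [_ h] := mult_closed D; apply: h; exact: valP. Qed.

Definition denM (s t : denom) : denom :=
  exist (fun x => x \in mult_carrier D) _ (denM_subproof s t).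

Lemma val_denM s t : dval (denM s t) = dval s * dval t. Proof. by []. Qed.
Lemma val_den1 : dval den1 = 1. Proof. by []. Qed.
Definition valE := (val_denM, val_den1).

Definition pair : Type := (A * denom)%type.
HB.instance Definition _ := Choice.on pair.
Implicit Types x y z : pair.

Definition equiv x y : bool :=
  `[< exists u : denom,
      dval u * (x.1 * dval y.2) = dval u * (y.1 * dval x.2) >].

Lemma equiv_refl : reflexive equiv.
Proof. by move=> x; apply/asboolP; exists den1. Qed.

Lemma equiv_sym : symmetric equiv.
Proof.
by move=> x y; apply/asboolP/asboolP => -[u hu]; exists u; rewrite hu.
Qed.

Lemma equiv_trans : transitive equiv.
Proof.
move=> y x z /asboolP[u hu] /asboolP[v hv]; apply/asboolP.
exists (denM (denM u v) y.2); rewrite !valE.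
have -> : dval u * dval v * dval y.2 * (x.1 * dval z.2)
   = dval v * dval z.2 * (dval u * (x.1 * dval y.2)) by ring.
rewrite hu.
have -> : dval v * dval z.2 * (dval u * (y.1 * dval x.2))
   = dval u * dval x.2 * (dval v * (y.1 * dval z.2)) by ring.
by rewrite hv; ring.
Qed.

Canonical equiv_equiv := EquivRel equiv equiv_refl equiv_sym equiv_trans.

Definition type := {eq_quot equiv}.
HB.instance Definition _ : EqQuotient _ equiv type := EqQuotient.on type.
HB.instance Definition _ := Choice.on type.

Definition frac (a : A) (s : denom) : type := \pi_type ((a, s) : pair).

Lemma frac_eq a s b t :
  (frac a s = frac b t) <->
  exists u : denom, dval u * (a * dval t) = dval u * (b * dval s).
Proof.
split=> [/eqmodP/asboolP //|h].
by apply/eqmodP/asboolP.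
Qed.

Lemma fracP (x : type) : exists a s, x = frac a s.
Proof. by elim/quotW: x => -[a s]; exists a, s. Qed.

Lemma repr_frac a s : exists u : denom,
  dval u * ((repr (frac a s)).1 * dval s) =
  dval u * (a * dval (repr (frac a s)).2).
Proof.
apply/frac_eq; rewrite /frac -[RHS]reprK; congr (\pi_type _).
by case: (repr _).
Qed.

Definition add (x y : type) : type :=
  let: (a, s) := repr x in let: (b, t) := repr y in
  frac (a * dval t + b * dval s) (denM s t).
Definition opp (x : type) : type := let: (a, s) := repr x in frac (- a) s.
Definition mul (x y : type) : type :=
  let: (a, s) := repr x in let: (b, t) := repr y in
  frac (a * b) (denM s t).

Lemma frac_add a s b t :
  add (frac a s) (frac b t) = frac (a * dval t + b * dval s) (denM s t).
Proof.
rewrite /add; have [u] := repr_frac a s; have [v] := repr_frac b t.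
case: (repr (frac a s)) => a' s'; case: (repr (frac b t)) => b' t' /= hv hu.
apply/frac_eq; exists (denM u v); rewrite !valE.
transitivity (dval v * dval t * dval t' * (dval u * (a' * dval s))
  + dval u * dval s * dval s' * (dval v * (b' * dval t))); first by ring.
by rewrite hu hv; ring.
Qed.

Lemma frac_opp a s : opp (frac a s) = frac (- a) s.
Proof.
rewrite /opp; have [u] := repr_frac a s.
case: (repr (frac a s)) => a' s' /= hu.
by apply/frac_eq; exists u; rewrite !mulNr !mulrN hu.
Qed.

Lemma frac_mul a s b t : mul (frac a s) (frac b t) = frac (a * b) (denM s t).
Proof.
rewrite /mul; have [u] := repr_frac a s; have [v] := repr_frac b t.
case: (repr (frac a s)) => a' s'; case: (repr (frac b t)) => b' t' /= hv hu.
apply/frac_eq; exists (denM u v); rewrite !valE.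
transitivity ((dval u * (a' * dval s)) * (dval v * (b' * dval t))); first by ring.
by rewrite hu hv; ring.
Qed.

Lemma addA : associative add.
Proof.
move=> x y z; have [a [s ->]] := fracP x; have [b [t ->]] := fracP y.
have [c [r ->]] := fracP z; rewrite !frac_add.
by apply/frac_eq; exists den1; rewrite !valE; ring.
Qed.

Lemma addC : commutative add.
Proof.
move=> x y; have [a [s ->]] := fracP x; have [b [t ->]] := fracP y.
by rewrite !frac_add; apply/frac_eq; exists den1; rewrite !valE; ring.
Qed.

Lemma add0 : left_id (frac 0 den1) add.
Proof.
move=> x; have [a [s ->]] := fracP x.
by rewrite frac_add; apply/frac_eq; exists den1; rewrite !valE; ring.
Qed.

Lemma addN : left_inverse (frac 0 den1) opp add.
Proof.
move=> x; have [a [s ->]] := fracP x.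
by rewrite frac_opp frac_add; apply/frac_eq; exists den1; rewrite !valE; ring.
Qed.

HB.instance Definition _ := GRing.isZmodule.Build type addA addC add0 addN.

Lemma mulA : associative mul.
Proof.
move=> x y z; have [a [s ->]] := fracP x; have [b [t ->]] := fracP y.
have [c [r ->]] := fracP z; rewrite !frac_mul.
by apply/frac_eq; exists den1; rewrite !valE; ring.
Qed.

Lemma mulC : commutative mul.
Proof.
move=> x y; have [a [s ->]] := fracP x; have [b [t ->]] := fracP y.
by rewrite !frac_mul; apply/frac_eq; exists den1; rewrite !valE; ring.
Qed.

Lemma mul1 : left_id (frac 1 den1) mul.
Proof.
move=> x; have [a [s ->]] := fracP x.
by rewrite frac_mul; apply/frac_eq; exists den1; rewrite !valE; ring.
Qed.

Lemma mulDl : left_distributive mul add.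
Proof.
move=> x y z; have [a [s ->]] := fracP x; have [b [t ->]] := fracP y.
have [c [r ->]] := fracP z; rewrite !(frac_add, frac_mul).
by apply/frac_eq; exists den1; rewrite !valE; ring.
Qed.

HB.instance Definition _ :=
  GRing.Zmodule_isComPzRing.Build type mulA mulC mul1 mulDl.

(* For B ⊆ A containing D, the localization B_D as a subset of A_D; the      *)
(* canonical map from B_D to A_D is injective.                                *)
Definition loc_sub (B : set A) : set type :=
  [set x | exists2 b, B b & exists s : denom, x = frac b s].

End Localization.
Arguments loc_sub {A} D B.
End Localization.
HB.export Localization.
Notation loc_sub := Localization.loc_sub.

(* R_P ⊆ S_P is chained for every prime ideal P of R, where X_P := X_{R \ P}. *)
Definition arithmetic (A : comPzRingType) (R S : set A) : Prop :=
  forall (P : set A) (hP : prime_ideal R P),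
  chained (loc_sub (prime_compl hP) R) (loc_sub (prime_compl hP) S).

(* Main.v *)
Require Import Defs.
From mathcomp Require Import all_boot all_order all_algebra.
From mathcomp Require Import ring.
From mathcomp Require Import boolp classical_sets functions cardinality.

(* Write [T] for the t-closure of [R]. For a minimal extension [W < U] in an  *)
(* integral FCP extension the conductor [(W : U)] is a maximal ideal of [W];  *)
(* if [U] is t-closed over [W] (inert case), then [U / (W : U)] is a field.   *)
(* In a catenarian extension an inert and a non-inert minimal extension of the*)
(* same ring [X] cannot have the same conductor, since their compositum would *)
(* carry maximal chains with 3 and with at least 4 elements. Climbing grids of*)
(* minimal extensions, one gets [(X : T) + (X : W) = X] whenever [R <= X <= T]*)
(* and [X <= W] is t-closed. For [U], [V] in [[R, S]] this applies to         *)
(* [Y = (U & T) + (V & T)] and splits a product [u v] into a part in          *)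
(* [(T + U) + (T + V)] scaled by [(Y : T)] and a part scaled by [(Y : Y + U)],*)
(* both of which lie in [U + V].                                              *)
(* Above [T] all minimal extensions are inert. If [U_P] and [V_P] are         *)
(* incomparable, one finds two distinct minimal extensions of some ring with  *)
(* the same conductor, i.e. field extensions [K], [L] of [k] with [K & L = k] *)
(* and [K + L] a ring; multiplication by [x] in [K \ k] embeds [L] in         *)
(* [(K + L) / L = K / k], so [[L : k] < [K : k]], and symmetrically.          *)

Set Implicit Arguments.
Unset Strict Implicit.
Unset Printing Implicit Defensive.

Import GRing.Theory.
Local Open Scope classical_set_scope.
Local Open Scope ring_scope.

(** The [Delta] property passes to subextensions, so two things need proof: gluing along [T], and
    the equivalence with arithmetic above [T]. Gluing ([Delta_glue]) rests on comaximal conductors.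
    Every ring of [[R, T]] other than [T] has a non-inert minimal extension inside [T], while
    [W & T <= W] is t-closed for every [W]. Catenarity makes the conductors of an inert and of a
    non-inert minimal extension comaximal ([comax_conductors]); [comax_minimal] and
    [comax_t_closure] propagate this to all [W]. A relation [s + m = 1] between conductors then
    splits mixed products into manageable pieces. That arithmetic implies [Delta] is a local check
    ([arithmetic_Delta]): the multipliers sending [u * v] into [U + V] form an ideal contained in no
    prime. Conversely, a prime [P] of [X] containing the conductors of [U] and [V] is the conductor
    of minimal inert extensions inside both ([prime_inert_ext]); these coincide by a degree count
    ([inert_ext_eq]), and one climbs ([Delta_locally_comparable]). *)

(** * Chains and extremal elements under FCP *)

Section Chains.
Variable A : comPzRingType.
Implicit Types (F C : set (set A)) (R S X Y : set A).

(** Zorn's lemma; the predicate speaks of the union of [C] with [C0] so that the empty family, whose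
    union is empty, is admissible too. *)
Lemma chain_extension F C0 : C0 `<=` F -> is_chain C0 ->
  exists C, [/\ C `<=` F, is_chain C, C0 `<=` C &
    forall C', C' `<=` F -> is_chain C' -> C `<=` C' -> C' = C].
Proof.
move=> C0F cC0.
pose P : set (set (set A)) := [set C | C `|` C0 `<=` F /\ is_chain (C `|` C0)].
have [G GP tG|C [[CF cC] Cmax]] := @Zorn_bigcup _ P.
  split=> [X [[C GC CX]|/C0F//]|X Y].
    by have [CF _] := GP _ GC; apply: CF; left.
  move=> [[C GC CX]|X0] [[C' GC' CY]|Y0]; last exact: cC0.
  - have [CC'|C'C] := tG _ _ GC GC'.
      by have [_ h] := GP _ GC'; apply: h; left => //; apply: CC'.
    by have [_ h] := GP _ GC; apply: h; left => //; apply: C'C.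
  - by have [_ h] := GP _ GC; apply: h; [left|right].
  - by have [_ h] := GP _ GC'; apply: h; [right|left].
exists (C `|` C0); split=> // C' C'F cC' sub.
apply/seteqP; split=> // X C'X.
have [CX|nCX] := pselect (C X); first by left.
have C0C' : C' `|` C0 = C' by apply/setUidPl => Y Y0; apply: sub; right.
exfalso; apply: (Cmax C'); last by rewrite /P /= C0C'.
split=> [Y CY|sub']; first by apply: sub; left.
by apply: nCX; apply: sub'.
Qed.

Lemma finite_chain_extrema C : finite_set C -> is_chain C -> C !=set0 ->
  (exists2 X, C X & forall Y, C Y -> Y `<=` X) /\
  (exists2 X, C X & forall Y, C Y -> X `<=` Y).
Proof.
move=> /finite_seqP[s ->] {C}; elim: s => [_ [X]|X s IH cs _] //.
have cs' : is_chain [set` s].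
  by move=> Y Z Ys Zs; apply: cs => /=; rewrite in_cons ?Ys ?Zs orbT.
have tot Y : Y \in s -> X `<=` Y \/ Y `<=` X.
  by move=> Ys; apply: cs; rewrite /= in_cons ?eqxx ?Ys ?orbT.
have [s0|s0] := pselect ([set` s] !=set0); last first.
  have h Y : Y \in X :: s -> Y = X.
    by rewrite in_cons => /orP[/eqP//|Ys]; case: s0; exists Y.
  by split; exists X => [|Y /h->]; rewrite /= ?in_cons ?eqxx.
have [[M Ms Mmax] [m ms mmin]] := IH cs' s0; split.
- have [XM|MX] := tot _ Ms.
    by exists M => [|Y]; rewrite /= in_cons ?Ms ?orbT// => /orP[/eqP->|/Mmax].
  exists X => [|Y]; rewrite /= in_cons ?eqxx// => /orP[/eqP->//|/Mmax].
  by move/subset_trans; apply.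
- have [Xm|mX] := tot _ ms; last first.
    by exists m => [|Y]; rewrite /= in_cons ?ms ?orbT// => /orP[/eqP->|/mmin].
  exists X => [|Y]; rewrite /= in_cons ?eqxx// => /orP[/eqP->//|/mmin].
  exact: subset_trans.
Qed.

(** A maximal chain of [F] is finite by FCP. Its greatest element is maximal in [F], as anything
    above it could be added to the chain; dually for the least one. *)
Lemma FCP_extremal R S F X0 : FCP R S -> F `<=` interm R S -> F X0 ->
  (exists2 X, F X & forall Y, F Y -> X `<=` Y -> Y = X) /\
  (exists2 X, F X & forall Y, F Y -> Y `<=` X -> Y = X).
Proof.
move=> fcp FI FX0.
have [||C [CF cC C0 Cmax]] := @chain_extension F [set X0].
- by move=> _ ->.
- by move=> _ _ -> ->; left.
have [|[M CM Mmax] [m Cm mmin]] :=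
  finite_chain_extrema (fcp _ (subset_trans CF FI) cC) cC.
  by exists X0; apply: C0.
have addC Y : F Y -> (forall Z, C Z -> Z `<=` Y \/ Y `<=` Z) -> C Y.
  move=> FY tot; have <- : C `|` [set Y] = C; last by right.
  apply: Cmax => [Z [/CF//|->//]||Z]; last by left.
  move=> Z Z' [CZ|->] [CZ'|->]; [exact: cC|exact: tot| |by left].
  by case: (tot _ CZ'); [right|left].
split.
- exists M => [|Y FY MY]; first exact: CF.
  apply/seteqP; split=> //; apply: (Mmax); apply: addC => // Z /Mmax ZM.
  by left; apply: subset_trans MY.
- exists m => [|Y FY Ym]; first exact: CF.
  apply/seteqP; split=> //; apply: (mmin); apply: addC => // Z /mmin mZ.
  by right; apply: subset_trans mZ.
Qed.

(** Noetherian induction downwards from the top: there would be a maximal counterexample. *)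
Lemma FCP_ind R S (Q : set A -> Prop) : FCP R S ->
  (forall X, interm R S X ->
     (forall Y, interm R S Y -> X `<` Y -> Q Y) -> Q X) ->
  forall X, interm R S X -> Q X.
Proof.
move=> fcp IH X IX; apply: contrapT => nQX.
have [|//|[M [IM nQM] Mmax] _] := @FCP_extremal R S
  [set X | interm R S X /\ ~ Q X] X fcp; first by move=> Y [].
apply: nQM; apply: IH => // Y IY [MY nYM].
by apply: contrapT => nQY; apply: nYM; rewrite (Mmax Y).
Qed.

End Chains.

(** * Subrings, sums of subrings and conductors *)

Section Subrings.
Variable A : comPzRingType.
Implicit Types (I R S T U V W X Y Z : set A) (a b x y : A).

Lemma is_subringP X : is_subring X <->
  [/\ X 1, forall x y, X x -> X y -> X (x - y)
    & forall x y, X x -> X y -> X (x * y)].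
Proof.
split=> [[h1 hB hM]|[h1 hB hM]].
  split; first by rewrite inE in h1.
    by move=> x y Xx Xy; have := hB x y; rewrite !inE; apply.
  by move=> x y Xx Xy; have := hM x y; rewrite !inE; apply.
by split=> [|x y|x y]; rewrite !inE//; [exact: hB|exact: hM].
Qed.

Lemma subr_1 X : is_subring X -> X 1.
Proof. by move/is_subringP; case. Qed.

Lemma subr_B X x y : is_subring X -> X x -> X y -> X (x - y).
Proof. by move/is_subringP; case=> _ + _; apply. Qed.

Lemma subr_M X x y : is_subring X -> X x -> X y -> X (x * y).
Proof. by move/is_subringP; case=> _ _; apply. Qed.

Lemma subr_0 X : is_subring X -> X 0.
Proof. by move=> hX; rewrite -(subrr 1); apply: subr_B => //; exact: subr_1. Qed.

Lemma subr_N X x : is_subring X -> X x -> X (- x).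
Proof. by move=> hX ?; rewrite -sub0r; apply: subr_B => //; exact: subr_0. Qed.

Lemma subr_D X x y : is_subring X -> X x -> X y -> X (x + y).
Proof.
by move=> hX ? ?; rewrite -[y]opprK; apply: subr_B => //; exact: subr_N.
Qed.

Lemma subr_X X x n : is_subring X -> X x -> X (x ^+ n).
Proof.
move=> hX Xx; elim: n => [|n IH]; first exact: subr_1.
by rewrite exprS; apply: subr_M.
Qed.

Lemma subr_sum X (J : Type) (r : seq J) (P : pred J) (F : J -> A) :
  is_subring X -> (forall j, P j -> X (F j)) -> X (\sum_(j <- r | P j) F j).
Proof.
move=> hX hF; elim/big_ind: _ => //; first exact: subr_0.
by move=> x y; apply: subr_D.
Qed.

Lemma subringI X Y : is_subring X -> is_subring Y -> is_subring (X `&` Y).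
Proof.
move=> hX hY; apply/is_subringP; split; first by split; exact: subr_1.
  by move=> x y [? ?] [? ?]; split; exact: subr_B.
by move=> x y [? ?] [? ?]; split; exact: subr_M.
Qed.

Lemma subringT : is_subring [set: A].
Proof. exact/is_subringP. Qed.

End Subrings.

(** Membership in a subring by closure, backtracking over the inclusions in the context when an atom
    is known only in a smaller set. *)
Ltac sr := solve [ solve [trivial] | multimatch goal with
  | |- _ (_ - _) => apply: subr_B; [assumption | sr | sr]
  | |- _ (_ + _) => apply: subr_D; [assumption | sr | sr]
  | |- _ (- _) => apply: subr_N; [assumption | sr]
  | |- _ (_ ^+ _) => apply: subr_X; [assumption | sr]
  | |- _ (_ * _) => apply: subr_M; [assumption | sr | sr]
  | |- _ 1 => apply: subr_1; assumption
  | |- _ 0 => apply: subr_0; assumption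
  | H : ?X `<=` ?Y |- ?Y _ => refine (H _ _); sr
  end ].

Section Sums.
Variable A : comPzRingType.
Implicit Types (I R S T U V W X Y Z : set A) (a b x y : A).

Definition sumset X Y : set A := [set x + y | x in X & y in Y].

Lemma sumsetI X Y x y : X x -> Y y -> sumset X Y (x + y).
Proof. by move=> Xx Yy; exists x => //; exists y. Qed.

Lemma sumset_sub X Y Z : is_subring Z -> X `<=` Z -> Y `<=` Z ->
  sumset X Y `<=` Z.
Proof. by move=> hZ XZ YZ _ [x Xx [y Yy <-]]; sr. Qed.

Lemma sumsetl X Y : Y 0 -> X `<=` sumset X Y.
Proof. by move=> Y0 x Xx; rewrite -[x]addr0; exact: sumsetI. Qed.

Lemma sumsetr X Y : X 0 -> Y `<=` sumset X Y.
Proof. by move=> X0 y Yy; rewrite -[y]add0r; exact: sumsetI. Qed.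

Lemma sumsetC X Y : sumset X Y = sumset Y X.
Proof.
by apply/seteqP; split=> _ [x Xx [y Yy <-]]; rewrite addrC; exact: sumsetI.
Qed.

Lemma sumset_subring X I : is_subring X -> I 0 ->
  (forall x y, I x -> I y -> I (x - y)) ->
  (forall x y, X x -> I y -> I (x * y)) ->
  (forall x y, I x -> I y -> sumset X I (x * y)) ->
  is_subring (sumset X I).
Proof.
move=> hX I0 IB IM II.
have ID x y : I x -> I y -> I (x + y).
  move=> Ix Iy; have -> : x + y = x - (0 - y) by ring.
  by apply: (IB) => //; exact: IB.
apply/is_subringP; split.
- by apply: sumsetl => //; exact: subr_1.
- move=> _ _ [x Xx [i Ii <-]] [y Xy [j Ij <-]].
  have -> : x + i - (y + j) = (x - y) + (i - j) by ring.
  by apply: sumsetI; [sr|exact: IB].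
- move=> _ _ [x Xx [i Ii <-]] [y Xy [j Ij <-]].
  have [z Xz [k Ik zk]] := II i j Ii Ij.
  have -> : (x + i) * (y + j) = (x * y + z) + (x * j + y * i + k).
    by transitivity (x * y + (x * j + y * i) + i * j); [ring|rewrite -zk; ring].
  by apply: sumsetI; [sr|apply: (ID) => //; apply: (ID); exact: IM].
Qed.

Definition multiples a X : set A := [set a * x | x in X].

Lemma multiplesI a X x : X x -> multiples a X (a * x).
Proof. by move=> Xx; exists x. Qed.

Lemma sumset_multiples_subring X U a : is_subring X -> is_subring U ->
  X `<=` U -> U a -> is_subring (sumset X (multiples a U)).
Proof.
move=> hX hU XU Ua; apply: sumset_subring => //.
- by exists 0; rewrite ?mulr0//; sr.
- by move=> _ _ [x Ux <-] [y Uy <-]; exists (x - y); [sr|ring].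
- by move=> x _ Xx [y Uy <-]; exists (x * y); [sr|ring].
- move=> _ _ [x Ux <-] [y Uy <-]; apply: sumsetr; first by sr.
  by exists (x * a * y); [sr|ring].
Qed.

(** With [c = b ^+ 2 - r * b], a product of two multiples of [b] is a multiple of [b] plus some
    [z * c], which lies in [X]. Allowing [Z] larger than [X] covers rings such as [X + W b]. *)
Lemma sumset_quadratic_subring X Z b r : is_subring X -> is_subring Z ->
  X `<=` Z -> Z r -> (forall z, Z z -> X (z * (b ^+ 2 - r * b))) ->
  is_subring (sumset X (multiples b Z)).
Proof.
move=> hX hZ XZ Zr hb; apply: sumset_subring => //.
- by exists 0; rewrite ?mulr0//; sr.
- by move=> _ _ [x Zx <-] [y Zy <-]; exists (x - y); [sr|ring].
- by move=> x _ Xx [y Zy <-]; exists (x * y); [sr|ring].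
- move=> _ _ [x Zx <-] [y Zy <-].
  have -> : b * x * (b * y) = x * y * (b ^+ 2 - r * b) + b * (r * x * y) by ring.
  by apply: sumsetI; [apply: hb; sr|apply: multiplesI; sr].
Qed.

Definition conductor W U : set A := [set a | W a /\ forall u, U u -> W (a * u)].

Lemma conductorM W U a u : is_subring U -> conductor W U a -> U u ->
  conductor W U (a * u).
Proof.
move=> hU [Wa aU] Uu; split; first exact: aU.
by move=> v Uv; rewrite -mulrA; apply: aU; sr.
Qed.

Lemma conductorMl W U a u : is_subring U -> conductor W U a -> U u ->
  conductor W U (u * a).
Proof. by rewrite mulrC; exact: conductorM. Qed.

Lemma conductorB W U a b : is_subring W ->
  conductor W U a -> conductor W U b -> conductor W U (a - b).
Proof.
move=> hW [Wa aU] [Wb bU]; split; first by sr.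
by move=> v Uv; rewrite mulrBl; apply: subr_B => //; [exact: aU|exact: bU].
Qed.

Lemma conductor0 W U : is_subring W -> conductor W U 0.
Proof. by move=> hW; split=> [|u _]; rewrite ?mul0r; sr. Qed.

Lemma conductorN W U a : is_subring W -> conductor W U a -> conductor W U (- a).
Proof.
by move=> hW ha; rewrite -sub0r; apply: conductorB => //; exact: conductor0.
Qed.

Lemma conductorD W U a b : is_subring W ->
  conductor W U a -> conductor W U b -> conductor W U (a + b).
Proof.
by move=> hW ha hb; rewrite -[b]opprK; apply: conductorB => //; exact: conductorN.
Qed.

Definition minimal_ext W U : Prop :=
  [/\ is_subring W, is_subring U, W `<` U &
      forall Z, is_subring Z -> W `<=` Z -> Z `<=` U -> Z = W \/ Z = U].

Lemma minimal_ext_top W U Z b : minimal_ext W U -> is_subring Z -> W `<=` Z ->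
  Z `<=` U -> Z b -> ~ W b -> Z = U.
Proof.
case=> _ _ _ h hZ WZ ZU Zb nWb; have [ZW|//] := h Z hZ WZ ZU.
by rewrite ZW in Zb.
Qed.

Lemma minimal_ext_ex W U : minimal_ext W U -> exists2 b, U b & ~ W b.
Proof.
case=> _ _ [_ nUW] _; apply: contrapT => h; apply: nUW => b Ub.
by apply: contrapT => nWb; apply: h; exists b.
Qed.

Lemma minimal_ext_nonconductor1 W U : minimal_ext W U -> ~ conductor W U 1.
Proof.
move=> h [_ h1]; have [b Ub] := minimal_ext_ex h.
by apply; rewrite -[b]mul1r; exact: h1.
Qed.

(* A scalar outside the conductor acts surjectively on [U / W]. *)
Lemma minimal_ext_mul W U a u : minimal_ext W U -> W a ->
  ~ conductor W U a -> U u ->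
  exists2 w, W w & exists2 v, U v & u = w + a * v.
Proof.
move=> h Wa na Uu; have [hW hU [WU _] _] := h.
have [v Uv nWav] : exists2 v, U v & ~ W (a * v).
  apply: contrapT => nex; apply: na; split=> // v Uv.
  by apply: contrapT => nW; apply: nex; exists v.
have E : sumset W (multiples a U) = U.
  apply: (minimal_ext_top h _ _ _ _ nWav).
  - by apply: sumset_multiples_subring => //; sr.
  - by apply: sumsetl; exists 0; [sr|rewrite mulr0].
  - by apply: sumset_sub => // _ [x Ux <-]; sr.
  - by apply: sumsetr; [sr|exact: multiplesI].
by move: Uu; rewrite -{1}E => -[w Ww [_ [x Ux <-] <-]]; exists w => //; exists x.
Qed.

(** * Integrality by spans of powers, and Nakayama's lemma *)

Definition power_span W b k : set A :=
  [set x | exists2 c : nat -> A, forall i, W (c i) &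
     x = \sum_(i < k) c i * b ^+ i].

(** A monic equation of degree [k], written without polynomials so that [A] may be the zero ring. *)
Definition power_integral W U : Prop :=
  forall b, U b -> exists k, power_span W b k (b ^+ k).

Section Span.
Variables (W : set A) (hW : is_subring W) (b : A).

Lemma spanB k x y : power_span W b k x -> power_span W b k y ->
  power_span W b k (x - y).
Proof.
move=> [c Wc ->] [d Wd ->]; exists (fun i => c i - d i) => [i|]; first by sr.
by rewrite -sumrB; apply: eq_bigr => i _; rewrite mulrBl.
Qed.

Lemma spanZ k w x : W w -> power_span W b k x -> power_span W b k (w * x).
Proof.
move=> Ww [c Wc ->]; exists (fun i => w * c i) => [i|]; first by sr.
by rewrite mulr_sumr; apply: eq_bigr => i _; rewrite mulrA.
Qed.

Lemma span0 k : power_span W b k 0.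
Proof.
exists (fun=> 0) => [i|]; first by sr.
by rewrite big1// => i _; rewrite mul0r.
Qed.

Lemma spanD k x y : power_span W b k x -> power_span W b k y ->
  power_span W b k (x + y).
Proof.
move=> hx hy; have -> : x + y = x - (0 - y) by ring.
by apply: spanB => //; apply: spanB => //; exact: span0.
Qed.

Lemma spanS k x : power_span W b k.+1 x <->
  exists2 y, power_span W b k y & exists2 w, W w & x = y + w * b ^+ k.
Proof.
split=> [[c Wc ->]|[_ [c Wc ->] [w Ww ->]]].
  exists (\sum_(i < k) c i * b ^+ i); first by exists c.
  by exists (c k); rewrite ?big_ord_recr.
exists (fun i => if (i < k)%N then c i else w); first by move=> i; case: ifP.
rewrite big_ord_recr /= ltnn; congr (_ + _).
by apply: eq_bigr => i _; rewrite ltn_ord.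
Qed.

Lemma span_leq k l x : (k <= l)%N -> power_span W b k x -> power_span W b l x.
Proof.
move=> /subnK <-; elim: (l - k)%N => // n IH /IH {}IH.
by rewrite addSn; apply/spanS; exists x => //; exists 0; [sr|ring].
Qed.

Lemma span_pow k i : (i < k)%N -> power_span W b k (b ^+ i).
Proof.
move=> ik; apply: (span_leq ik); apply/spanS; exists 0; first exact: span0.
by exists 1; [sr|ring].
Qed.

Lemma span_sub k U : is_subring U -> W `<=` U -> U b -> power_span W b k `<=` U.
Proof. by move=> hU WU Ub _ [c Wc ->]; apply: subr_sum => // i _; sr. Qed.

(* Nakayama's lemma for [power_span W b k] modulo [W], by eliminating the     *)
(* generators [b ^+ i] one at a time; [d] only serves the induction.          *)
Lemma nakayama_span a k d : W a ->
  (exists2 w, W w & d = 1 + a * w) ->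
  (forall x, power_span W b k x ->
     exists2 w, W w & exists2 y, power_span W b k y & d * x = w + a * y) ->
  exists2 c, (exists2 w, W w & c = 1 + a * w)
    & forall x, power_span W b k x -> W (c * x).
Proof.
move=> Wa; elim: k d => [|k IH] d [d' Wd' dE] hd.
  exists d; first by exists d'.
  by move=> _ [c _ ->]; rewrite big_ord0 mulr0; sr.
have [|w Ww [_ /spanS[y hy [w' Ww' ->]] bE]] := hd (b ^+ k).
  exact: span_pow.
(* Moving the [b ^+ k] term to the left gives [e * b ^+ k = w + a * y] with [y] free of [b ^+ k];
   multiplying all relations by [e], still 1 modulo [a], eliminates this generator. *)
pose e := d - a * w'.
have eb : e * b ^+ k = w + a * y by rewrite mulrBl bE; ring.
have We : W e by rewrite /e dE; sr.
have [|x hx|c [c' Wc' cE] hc] := IH (d * e).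
- exists (d' + d' * e - w'); first by sr.
  by rewrite /e dE; ring.
- have [|w1 Ww1 [_ /spanS[y1 hy1 [w2 Ww2 ->]] dx]] := hd x.
    by apply: span_leq hx.
  exists (e * w1 + a * w2 * w); first by sr.
  exists (e * y1 + w2 * a * y).
    by apply: spanD; apply: spanZ => //; sr.
  transitivity (e * (d * x)); first by ring.
  rewrite dx; transitivity (e * w1 + a * e * y1 + a * w2 * (e * b ^+ k)).
    by ring.
  by rewrite eb; ring.
exists (c * e).
  exists (d' - w' + c' * e); first by sr.
  by rewrite cE /e dE; ring.
move=> _ /spanS[x hx [w1 Ww1 ->]].
have -> : c * e * (x + w1 * b ^+ k) = e * (c * x) + w1 * c * (e * b ^+ k).
  by ring.
have Wcx := hc x hx; have Wcy := hc y hy.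
rewrite eb.
have -> : e * (c * x) + w1 * c * (w + a * y) =
          e * (c * x) + w1 * (c * w + a * (c * y)) by ring.
have Wc : W c by rewrite cE; sr.
sr.
Qed.

Lemma span_mulb k x : power_span W b k (b ^+ k) ->
  power_span W b k x -> power_span W b k (b * x).
Proof.
move=> hk [c Wc ->]; have : power_span W b k.+1 (b * \sum_(i < k) c i * b ^+ i).
  exists (fun i => if i is j.+1 then c j else 0); first by case=> [|i]; sr.
  rewrite big_ord_recl /= mul0r add0r mulr_sumr.
  by apply: eq_bigr => i _; rewrite exprS; ring.
by move=> /spanS[y hy [w Ww ->]]; apply: spanD => //; exact: spanZ.
Qed.

Lemma span_mul k x y : power_span W b k (b ^+ k) ->
  power_span W b k x -> power_span W b k y -> power_span W b k (x * y).
Proof.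
move=> hk [c Wc ->] hy; rewrite mulr_suml.
elim/big_ind: _ => [||i _]; [exact: span0|by move=> *; exact: spanD|].
rewrite -mulrA; apply: spanZ => //; elim: (nat_of_ord i) => [|n IH].
  by rewrite mul1r.
by rewrite exprS -mulrA; apply: span_mulb.
Qed.

Lemma span_1 k : power_span W b k (b ^+ k) -> power_span W b k 1.
Proof. by case: k => [//|k] _; rewrite -(expr0 b); exact: span_pow. Qed.

Lemma span_subring k : power_span W b k (b ^+ k) -> is_subring (power_span W b k).
Proof.
move=> hk; apply/is_subringP; split; [exact: span_1|exact: spanB|].
by move=> x y; exact: span_mul.
Qed.

(** The span is the ring [W[b]]. So [U] is a finite module over [W], as Nakayama's lemma
    requires. *)
Lemma minimal_ext_span k U : power_span W b k (b ^+ k) -> minimal_ext W U ->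
  U b -> ~ W b -> power_span W b k = U.
Proof.
move=> hk hm Ub nWb; have [_ hU [WU _] _] := hm.
apply: (minimal_ext_top hm _ _ _ _ nWb).
- exact: span_subring.
- by move=> w Ww; rewrite -[w]mulr1; apply: spanZ => //; exact: span_1.
- exact: span_sub.
- by have := span_mulb hk (span_1 hk); rewrite mulr1.
Qed.

End Span.

(** By [minimal_ext_mul], [a] acts surjectively on the finite module [U / W]; Nakayama's lemma gives
    some [1 + a * w] that kills it. *)
Lemma conductor_maximal W U a : minimal_ext W U -> power_integral W U -> W a ->
  ~ conductor W U a -> exists2 w, W w & conductor W U (1 + a * w).
Proof.
move=> hm hi Wa na; have [b Ub nWb] := minimal_ext_ex hm.
have [k hk] := hi b Ub; have [hW hU [WU _] _] := hm.
have E := minimal_ext_span hW hk hm Ub nWb.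
have [|x hx|c [w Ww cE] hc] := @nakayama_span W hW b a k 1 Wa.
- by exists 0; [sr|ring].
- have [|w Ww [v Uv xE]] := minimal_ext_mul hm Wa na (u := x).
    by rewrite -E.
  by exists w => //; exists v; rewrite ?mul1r// E.
exists w => //; rewrite -cE; split; first by rewrite cE; sr.
by move=> u Uu; apply: hc; rewrite E.
Qed.

End Sums.

(** * Minimal extensions *)

Section Inert.
Variable A : comPzRingType.
Implicit Types (R S T U V W X Y Z : set A) (a b r u v x y : A).

Lemma t_closed_trans X Y Z : X `<=` Y -> t_closed X Y -> t_closed Y Z ->
  t_closed X Z.
Proof.
move=> XY tXY tYZ b r Zb Xr h2 h3; apply: (tXY b r) => //.
by apply: (tYZ b r); [|exact: XY..].
Qed.

Lemma t_closed_subset X Y Z : Y `<=` Z -> t_closed X Z -> t_closed X Y.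
Proof. by move=> YZ tX b r Yb; apply: tX; exact: YZ. Qed.

Lemma not_t_closedP X Y : ~ t_closed X Y <->
  exists b r, [/\ Y b, ~ X b, X r, X (b ^+ 2 - r * b) & X (b ^+ 3 - r * b ^+ 2)].
Proof.
split=> [nt|[b [r [Yb nXb Xr h2 h3]]] t]; last by apply/nXb/(t b r).
apply: contrapT => nex; apply: nt => b r Yb Xr h2 h3.
by apply: contrapT => nXb; apply: nex; exists b, r.
Qed.

Definition inert_ext W U : Prop := minimal_ext W U /\ t_closed W U.

(* For a non-unit [u] modulo the conductor [M], either [W + u^2 U = W], which *)
(* puts [u^2] and [u^3] in [W], or [u = u^2 x] mod [M], which makes [u x]     *)
(* idempotent mod [M]; t-closedness excludes both.                            *)
Lemma inert_unit W U u : inert_ext W U -> power_integral W U -> U u ->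
  ~ conductor W U u -> exists2 v, U v & conductor W U (u * v - 1).
Proof.
move=> [hm tc] hi Uu nu; have [hW hU [WU _] hZ] := hm.
have max := conductor_maximal hm hi.
apply: contrapT => nv.
(* An element of [W] that is a multiple of [u] modulo the conductor lies in it; otherwise its
   inverse would provide one for [u]. *)
have unitW x m : U x -> conductor W U m -> W (u * x + m) ->
    conductor W U (u * x + m).
  move=> Ux hm' Wy; apply: contrapT => ny; have [w Ww hw] := max _ Wy ny.
  apply: nv; exists (- (x * w)); first by sr.
  have -> : u * - (x * w) - 1 = m * w - (1 + (u * x + m) * w) by ring.
  by apply: conductorB => //; apply: conductorM => //; sr.
have M0 : conductor W U 0 by exact: conductor0.
have nWu : ~ W u.
  by move=> Wu; apply: nu; have := unitW 1 0; rewrite mulr1 addr0; apply=> //; sr.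
have [|||E|E] := hZ (sumset W (multiples (u ^+ 2) U)).
- by apply: sumset_multiples_subring => //; sr.
- by apply: sumsetl; exists 0; [sr|rewrite mulr0].
- by apply: sumset_sub => // _ [x Ux <-]; sr.
- have hu2 x : U x -> W (u ^+ 2 * x).
    by move=> Ux; rewrite -E; apply: sumsetr; [sr|exact: multiplesI].
  apply/nWu/(tc u 0) => //; first by sr.
    by have := hu2 1; rewrite mulr1 mul0r subr0; apply; sr.
  by have := hu2 u Uu; rewrite mul0r subr0 -exprSr.
have [w Ww [_ [x Ux <-] uE]] : sumset W (multiples (u ^+ 2) U) u by rewrite E.
have wE : u * (1 - u * x) + 0 = w.
  by rewrite addr0 -[w](addrK (u ^+ 2 * x)) uE; ring.
have Mw : conductor W U w by rewrite -wE; apply: unitW; rewrite ?wE//; sr.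
have We2 : conductor W U ((u * x) ^+ 2 - 1 * (u * x)).
  have -> : (u * x) ^+ 2 - 1 * (u * x) = - x * (u * (1 - u * x) + 0) by ring.
  by rewrite wE; apply: conductorMl => //; sr.
have We : W (u * x).
  apply: (tc (u * x) 1); [by sr|by sr|by case: We2|].
  have -> : (u * x) ^+ 3 - 1 * (u * x) ^+ 2 =
    ((u * x) ^+ 2 - 1 * (u * x)) * (u * x) by ring.
  by have [_] := We2; apply; sr.
have Me : conductor W U (u * x) by have := unitW x 0; rewrite addr0; apply.
apply: nu; rewrite -uE; apply: conductorD => //.
have -> : u ^+ 2 * x = u * (u * x) by ring.
exact: conductorMl.
Qed.

(** Let [M] be the conductor, so [Z / M] is a field. A bad [b] over [Z] is rescaled by elements of
    [M], or by an inverse of [r] modulo [M], until its relations have coefficients in [X]. *)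
Lemma t_closed_inert_up X Z Z1 : inert_ext X Z -> power_integral X Z ->
  is_subring Z1 -> Z `<=` Z1 -> t_closed X Z1 -> t_closed Z Z1.
Proof.
move=> hin hi hZ1 ZZ1 tc b r Zb1 Zr Zc Zbc; apply: contrapT => nZb.
have unit := inert_unit hin hi.
have [[hX hZ [XZ _] _] _] := hin.
set c := b ^+ 2 - r * b in Zc; pose M := conductor X Z.
have cbE : c * b = b ^+ 3 - r * b ^+ 2 by rewrite /c; ring.
have MZ m : M m -> Z m by case=> /XZ.
have MM m z : M m -> Z z -> M (m * z) by move=> *; exact: conductorM.
have [[m Mm nZmb]|h] := pselect (exists2 m, M m & ~ Z (m * b)).
  have Zm := MZ _ Mm; have [Xm mZ] := Mm.
  apply/nZmb/XZ/(tc (m * b) (m * r)); first by sr.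
  - exact: mZ.
  - have -> : (m * b) ^+ 2 - m * r * (m * b) = m * (m * c) by rewrite /c; ring.
    by apply: mZ; sr.
  - have -> : (m * b) ^+ 3 - m * r * (m * b) ^+ 2 =
      m * (m ^+ 2 * (b ^+ 3 - r * b ^+ 2)) by ring.
    by apply: mZ; sr.
have Mb m : M m -> Z (m * b).
  by move=> Mm; apply: contrapT => nZ; apply: h; exists m.
(* A [z] invertible modulo [M] would put [b] in [Z]. *)
have MZb z : Z z -> Z (z * b) -> M z.
  move=> Zz Zzb; apply: contrapT => nMz; have [v Zv Mv] := unit _ Zz nMz.
  apply: nZb; have -> : b = v * (z * b) - (z * v - 1) * b by ring.
  by have ? := Mb _ Mv; sr.
have Mc : M c by apply: MZb; rewrite ?cbE.
have Mbb m : M m -> M (m * b).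
  move=> Mm; have Zmb := Mb _ Mm; have Zm := MZ _ Mm; apply: MZb => //.
  have -> : m * b * b = r * (m * b) + m * c by rewrite /c; ring.
  by sr.
(* If [r] is in [M], then [b ^+ 2] and [b ^+ 3] are in [M] and t-closedness applies with [r = 0];
   otherwise [v * b] is idempotent modulo [M] for an inverse [v] of [r], and it applies with
   [r = 1]. *)
have [Mr|nMr] := pselect (M r).
  have Mb2 : M (b ^+ 2).
    have -> : b ^+ 2 = c + r * b by rewrite /c; ring.
    by apply: conductorD => //; exact: Mbb.
  apply/nZb/XZ/(tc b 0) => //; rewrite ?mul0r ?subr0; first by sr.
    by case: Mb2.
  by rewrite exprSr; case: (Mbb _ Mb2).
have [v Zv Mv] := unit _ Zr nMr.
have Mvb : M ((v * b) ^+ 2 - 1 * (v * b)).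
  have -> : (v * b) ^+ 2 - 1 * (v * b) = (r * v - 1) * b * v + c * v ^+ 2.
    by rewrite /c; ring.
  by apply: conductorD => //; apply: MM; [exact: Mbb|sr|done|sr].
have Zvb : Z (v * b).
  apply/XZ/(tc (v * b) 1); [by sr|by sr|by case: Mvb|].
  have -> : (v * b) ^+ 3 - 1 * (v * b) ^+ 2 =
    ((v * b) ^+ 2 - 1 * (v * b)) * v * b by ring.
  by have [] : M (((v * b) ^+ 2 - 1 * (v * b)) * v * b) by apply: Mbb; exact: MM.
apply: nZb; have -> : b = r * (v * b) - (r * v - 1) * b by ring.
by have ? := Mb _ Mv; sr.
Qed.

(** The two minimal steps form a maximal chain of 3 elements, while the other chain, of 4 elements,
    extends to a maximal one. *)
Lemma catenarian_no_longer_chain R S X W B Y V : catenarian R S ->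
  interm R S X -> interm R S B -> minimal_ext X W -> minimal_ext W B ->
  is_subring Y -> is_subring V -> X `<` Y -> Y `<` V -> V `<` B -> False.
Proof.
move=> [_ cat] IX IB mXW mWB hY hV XY YV VB.
have [hX hW [XW nWX] minW] := mXW; have [_ hB [WB nBW] minB] := mWB.
have XB := subset_trans XW WB.
pose f i := nth X [:: X; Y; V; B] i; pose g i := nth X [:: X; W; B] i.
have gC : maximal_chain X B (g @` `I_3).
  have gI : g @` `I_3 `<=` interm X B.
    by move=> _ [[|[|[|//]]] _ <-]; split.
  have cg : is_chain (g @` `I_3).
    move=> _ _ [[|[|[|//]]] _ <-] [[|[|[|//]]] _ <-]; by [left|right].
  split=> // C' C'I cC' sub; apply/seteqP; split=> // Z C'Z.
  have [hZ XZ ZB] := C'I _ C'Z.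
  have C'W : C' W by apply: sub; exists 1%N.
  have [ZW|WZ] := cC' _ _ C'Z C'W.
    by have [->|->] := minW Z hZ XZ ZW; [exists 0%N|exists 1%N].
  by have [->|->] := minB Z hZ WZ ZB; [exists 1%N|exists 2%N].
have [XY' nYX] := XY; have [YV' nVY] := YV; have [VB' nBV] := VB.
have XV := subset_trans XY' YV'; have YB := subset_trans YV' VB'.
have [||C' [C'I cC' fC' C'max]] := @chain_extension _ (interm X B) (f @` `I_4).
- by move=> _ [[|[|[|[|//]]]] _ <-]; split.
- by move=> _ _ [[|[|[|[|//]]]] _ <-] [[|[|[|[|//]]]] _ <-]; by [left|right].
have /(cat _ _ IX IB XB _ _ gC) : maximal_chain X B C' by [].
rewrite card_eq_sym card_eq_le => /andP[C'g _].
have finj : {in `I_4 &, injective f}.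
  have ne (P Q : set A) : ~ Q `<=` P -> P <> Q.
    by move=> QP PQ; apply: QP; rewrite PQ.
  have := (ne _ _ nYX, ne _ _ nVY, ne _ _ nBV).
  have : X <> V /\ Y <> B /\ X <> B.
    split; [apply: ne => VX|split; apply: ne => ?].
    - by apply: nVY; apply: subset_trans VX _.
    - by apply: nBV; apply: subset_trans YV'.
    - by apply: nBV; apply: subset_trans XV.
  move=> [? [? ?]] [[? ?] ?] i j; rewrite !inE.
  by case: i j => [|[|[|[|//]]]] [|[|[|[|//]]]] _ _ //; rewrite /f /=; congruence.
have /andP[_ h4] : (f @` `I_4 #<= `I_4)%card && (`I_4 #<= f @` `I_4)%card.
  by rewrite -card_eq_le; exact: inj_card_eq.
have := card_le_trans (card_le_trans h4 (subset_card_le fC'))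
  (card_le_trans C'g (card_image_le _ _)).
by rewrite card_le_II.
Qed.

End Inert.

(** * Comaximality of conductors *)

Section Comaximal.
Variable A : comPzRingType.
Implicit Types (R S T U V W X Y Z : set A) (a b r u v x y : A).

Lemma exists_minimal_ext R S X U : FCP R S -> interm R S X -> interm R S U ->
  X `<` U -> exists2 W, minimal_ext X W & W `<=` U.
Proof.
move=> fcp [hX RX XS] [hU RU US] [XU nUX].
have [||_ [W [hW XW WU nWX] Wmin]] := @FCP_extremal A R S
  [set W | [/\ is_subring W, X `<=` W, W `<=` U & ~ W `<=` X]] U fcp.
- move=> W [hW XW WU _]; split=> //; first exact: subset_trans XW.
  exact: subset_trans US.
- by split.
exists W => //; split=> // Z hZ XZ ZW.
have [ZX|nZX] := pselect (Z `<=` X); first by left; apply/seteqP.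
by right; apply: Wmin => //; split=> //; exact: subset_trans WU.
Qed.

(** Comaximality of [(X : Y)] and [(X : W)], kept as witnesses since they serve as multipliers. *)
Definition comax X Y W : Prop :=
  exists s m, [/\ conductor X Y s, conductor X W m & s + m = 1].

(* Otherwise both conductors equal the same [M], and with [Y = X + X b] the   *)
(* chains [X < W < W + W b] and [X < Y < X + W b < W + W b] violate           *)
(* catenarity.                                                                *)
Lemma comax_conductors R X W Y : catenarian R [set: A] -> R `<=` X ->
  power_integral X W -> inert_ext X W -> minimal_ext X Y -> ~ t_closed X Y ->
  comax X Y W.
Proof.
move=> cat RX hi hin mXY /not_t_closedP[b [r [Yb nXb Xr Xc Xbc]]].
have [mXW tW] := hin; have [hX hW [XW _] _] := mXW; have [_ hY [XY _] _] := mXY.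
have unit := inert_unit hin hi; have max := conductor_maximal mXW hi.
set c := b ^+ 2 - r * b in Xc; pose M := conductor X W; pose I := conductor X Y.
(* [M] is maximal, so an [s] outside it gives comaximality at once; what remains is [I <= M]. *)
have [[s Is nMs]|h] := pselect (exists2 s, I s & ~ M s).
  have [w Ww Mw] := max s (proj1 Is) nMs.
  exists (- (s * w)), (1 + s * w); split=> //; last by ring.
  by apply: conductorN => //; apply: conductorM => //; exact: XY.
exfalso; have IM s : I s -> M s.
  by move=> Is; apply: contrapT => nM; apply: h; exists s.
have nM1 : ~ M 1 by exact: minimal_ext_nonconductor1 mXW.
have quad V : is_subring V -> X `<=` V -> (forall z, V z -> X (z * c)) ->
    is_subring (sumset X (multiples b V)).
  by move=> hV XV hc; apply: sumset_quadratic_subring hc => //; exact: XV.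
have hXb : is_subring (sumset X (multiples b X)) by apply: quad => // z Xz; sr.
have mb0 V : is_subring V -> multiples b V 0.
  by move=> hV; exists 0; [sr|rewrite mulr0].
have mb1 V : is_subring V -> multiples b V b.
  by move=> hV; exists 1; [sr|rewrite mulr1].
have Xb_sub : sumset X (multiples b X) `<=` Y.
  by apply: sumset_sub => // _ [x Xx <-]; sr.
have YE : sumset X (multiples b X) = Y.
  apply: (minimal_ext_top mXY _ _ _ _ nXb) => //.
    by apply: sumsetl; exact: mb0.
  by apply: sumsetr; [sr|exact: mb1].
have conductorY a : X a -> X (a * b) -> I a.
  move=> Xa Xab; split=> // y; rewrite -YE => -[x Xx [_ [z Xz <-] <-]].
  have -> : a * (x + b * z) = a * x + a * b * z by ring.
  by sr.
(* Otherwise [b = x + m * v] with [v = y + b * z], so [1 - m * z] multiplies [b] into [X], hence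
   lies in [I] and in [M], which forces 1 into [M]. *)
have MI m : M m -> I m.
  move=> Mm; apply: contrapT => nIm; have Xm := proj1 Mm.
  have [x Xx [v]] := minimal_ext_mul mXY Xm nIm Yb.
  rewrite -YE => -[y Xy [_ [z Xz <-] <-]] bE.
  have : I (1 - m * z).
    apply: conductorY; first by sr.
    suff -> : (1 - m * z) * b = x + m * y by sr.
    by rewrite mulrBl mul1r [X in X - _]bE; ring.
  move=> /IM M1; apply: nM1; have -> : 1 = (1 - m * z) + m * z by ring.
  by apply: conductorD => //; apply: conductorM => //; exact: XW.
have Mb m : M m -> X (m * b) by move=> /MI[_]; apply.
have MM m z : M m -> W z -> M (m * z) by move=> *; exact: conductorM.
have Mc : M c.
  apply: IM; apply: conductorY => //.
  by have -> : c * b = b ^+ 3 - r * b ^+ 2 by rewrite /c; ring.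
have MX m : M m -> X m by case.
(* If [b] were in [W], it would be invertible modulo [M], and [c = b * (b - r)] in [M] would give
   [b - r] in [M]. *)
have nWb : ~ W b.
  move=> Wb; have [Mb'|nMb] := pselect (M b); first exact/nXb/MX.
  have [v Wv Mv] := unit b Wb nMb.
  have : M (b - r).
    have -> : b - r = c * v - (b * v - 1) * (b - r) by rewrite /c; ring.
    by apply: conductorB => //; apply: MM => //; apply: subr_B => //; exact: XW.
  move=> /MX Xbr; apply: nXb; have -> : b = (b - r) + r by ring.
  by sr.
have Wdiv u : W u -> ~ M u -> exists v z, [/\ W v, M z & b * u * v = b + z * b].
  move=> Wu nMu; have [v Wv Mv] := unit u Wu nMu.
  by exists v, (u * v - 1); split=> //; ring.
have cW z : W z -> X (z * c) by move=> Wz; apply/MX; apply: conductorMl.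
pose B := sumset W (multiples b W).
have hB : is_subring B.
  apply: (@sumset_quadratic_subring _ W W b r) => //; first exact: XW.
  by move=> z Wz; apply/XW/cW.
have hV := quad W hW XW cW.
have WB : W `<=` B by apply: sumsetl; exact: mb0.
have Bb : B b by apply: sumsetr; [sr|exact: mb1].
have [w Ww nXw] := minimal_ext_ex mXW.
have mWB : minimal_ext W B.
  split=> // [|Z hZ WZ ZB]; first by split=> // BW; apply/nWb/BW.
  have [ZW|nZW] := pselect (Z `<=` W); [by left; apply/seteqP|right].
  have [z Zz nWz] : exists2 z, Z z & ~ W z.
    apply: contrapT => nex; apply: nZW => z Zz; apply: contrapT => nWz.
    by apply: nex; exists z.
  have [u0 Wu0 [_ [u1 Wu1 <-] zE]] := ZB z Zz.
  have nMu1 : ~ M u1.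
    move=> /Mb Xub; apply: nWz; rewrite -zE mulrC.
    by apply: subr_D => //; exact: XW.
  have [v [m [Wv /Mb Xmb bE]]] := Wdiv u1 Wu1 nMu1.
  have Zb : Z b.
    have -> : b = v * (u0 + b * u1 - u0) - m * b.
      by rewrite -[b in LHS](addrK (m * b)) -bE; ring.
    by rewrite zE; have ? := XW _ Xmb; sr.
  by apply/seteqP; split=> //; apply: sumset_sub => // _ [x Wx <-]; sr.
apply: (catenarian_no_longer_chain cat _ _ mXW mWB hY hV).
- by split.
- by split=> //; apply: subset_trans WB; exact: subset_trans XW.
- by case: mXY.
- split.
    rewrite -YE; apply: sumset_sub => //.
      by apply: sumsetl; exact: mb0.
    by move=> _ [x Xx <-]; apply: sumsetr; [sr|apply: multiplesI; exact: XW].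
  (* For [w] in [W] but not in [X], [b * w = x + b * z] gives [b * (w - z)] in [X] with [w - z]
     outside [M]; dividing puts [b] in [W]. *)
  move=> VY; have : Y (b * w).
    by apply: VY; apply: sumsetr; [sr|exact: multiplesI].
  rewrite -YE => -[x Xx [_ [z Xz <-] E]].
  have Wwz : W (w - z) by have ? := XW _ Xz; sr.
  have nMwz : ~ M (w - z).
    by move=> /MX Xwz; apply: nXw; rewrite -[w](subrK z); sr.
  have [v [m [Wv /Mb Xmb bE]]] := Wdiv _ Wwz nMwz; apply: nWb.
  have -> : b = x * v - m * b.
    rewrite -[b in LHS](addrK (m * b)) -bE; congr (_ - _).
    by rewrite mulrBr -E; ring.
  by have ? := XW _ Xmb; have ? := XW _ Xx; sr.
- split.
    apply: sumset_sub => //; first exact: subset_trans WB.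
    by move=> _ [x Wx <-]; have ? := WB _ Wx; sr.
  move=> BV; have /BV[x Xx [_ [u Wu <-] E]] := WB _ Ww.
  have nMu : ~ M u.
    move=> /Mb Xub; apply: nXw; rewrite -E mulrC; sr.
  have [v [m [Wv /Mb Xmb bE]]] := Wdiv _ Wu nMu; apply: nWb.
  have -> : b = (w - x) * v - m * b.
    by rewrite -[b in LHS](addrK (m * b)) -bE -E; ring.
  by have ? := XW _ Xmb; have ? := XW _ Xx; sr.
Qed.

(** A mixed product is [w * y = w * (s * y) + y * (m * w)], with [s * y] and [m * w] in [X]. *)
Lemma comax_sumset_subring X Y W : is_subring X -> is_subring Y ->
  is_subring W -> X `<=` Y -> X `<=` W -> comax X Y W ->
  is_subring (sumset W Y).
Proof.
move=> hX hY hW XY XW [s [m [[Xs sY] [Xm mW] sm]]].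
apply/is_subringP; split.
- by apply: sumsetl; sr.
- move=> _ _ [w Ww [y Yy <-]] [w' Ww' [y' Yy' <-]].
  have -> : w + y - (w' + y') = (w - w') + (y - y') by ring.
  by apply: sumsetI; sr.
- move=> _ _ [w Ww [y Yy <-]] [w' Ww' [y' Yy' <-]].
  have -> : (w + y) * (w' + y') =
     (w * w' + w * (s * y') + w' * (s * y)) + (y * y' + y' * (m * w) + y * (m * w')).
    transitivity (w * w' + y * y' + (s + m) * (w * y' + w' * y)); last by ring.
    by rewrite sm; ring.
  have ? := sY _ Yy; have ? := sY _ Yy'; have ? := mW _ Ww; have ? := mW _ Ww'.
  by apply: sumsetI; sr.
Qed.

(** Multiplication by [s] brings the relations of [b] down to [X], so [s * b] is in [X]; the rest
    [m * b] lies in [Y] anyway. *)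
Lemma comax_t_closed X Y W : is_subring X -> is_subring Y -> is_subring W ->
  X `<=` Y -> X `<=` W -> comax X Y W -> t_closed X W ->
  t_closed Y (sumset W Y).
Proof.
move=> hX hY hW XY XW [s [m [[Xs sY] [Xm mW] sm]]] tc.
move=> _ r [w Ww [y Yy <-]] Yr; set b := w + y => h2 h3.
have Xsb : X (s * b).
  apply: (tc (s * b) (s * r)).
  - have ? := sY _ Yy; have -> : s * b = s * w + s * y by rewrite /b; ring.
    by sr.
  - exact: sY.
  - have -> : (s * b) ^+ 2 - s * r * (s * b) = s * (s * (b ^+ 2 - r * b)) by ring.
    by apply: subr_M => //; exact: sY.
  - have -> : (s * b) ^+ 3 - s * r * (s * b) ^+ 2 =
      s ^+ 2 * (s * (b ^+ 3 - r * b ^+ 2)) by ring.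
    by apply: subr_M; [|sr|exact: sY].
have -> : b = s * b + (m * w + m * y) by rewrite -[b in LHS]mul1r -sm /b; ring.
by have ? := mW _ Ww; sr.
Qed.

Variables R T : set A.
Hypothesis cat : catenarian R [set: A].
Hypothesis int : power_integral R [set: A].

Lemma power_integral_up X W : R `<=` X -> power_integral X W.
Proof.
move=> RX b _; have [k [c Rc bE]] := int (b := b) I.
by exists k, c => // i; exact: RX.
Qed.

(** One inert step [X < W1] inside [W] is handled by [comax_conductors]; then [W1 < W1 + Y] is again
    minimal and not t-closed, and the induction continues at [W1]. *)
Lemma comax_minimal X Y W : interm R [set: A] X -> minimal_ext X Y ->
  ~ t_closed X Y -> is_subring W -> X `<=` W -> t_closed X W -> comax X Y W.
Proof.
have fcp := proj1 cat.
move=> IX; move: Y; move: X IX.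
apply: (FCP_ind fcp) => X IX IH Y mXY ntXY hW XW tc.
have [hX RX _] := IX; have [_ hY [XY _] minY] := mXY.
have [WX|nWX] := pselect (W `<=` X).
  exists 0, 1; split; rewrite ?add0r//; first exact: conductor0.
  by split=> [|u Wu]; rewrite ?mul1r; [sr|exact: WX].
have IW : interm R [set: A] W by split=> //; exact: subset_trans XW.
have [//|W1 mXW1 W1W] := exists_minimal_ext fcp IX IW.
have [_ hW1 [XW1 nW1X] _] := mXW1.
have inW1 : inert_ext X W1 by split=> //; exact: t_closed_subset tc.
have cXY1 := comax_conductors cat RX (power_integral_up RX) inW1 mXY ntXY.
have hU := comax_sumset_subring hX hY hW1 XY XW1 cXY1; set U := sumset W1 Y in hU.
have [s [m [[Xs sY] [Xm mW1] sm]]] := cXY1.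
have W1U : W1 `<=` U by apply: sumsetl; sr.
have YU : Y `<=` U by apply: sumsetr; sr.
have [b [r [Yb nXb Xr h2 h3]]] := iffLR (not_t_closedP X Y) ntXY.
have nW1b : ~ W1 b.
  move=> W1b; apply: nXb; rewrite -[b]mul1r -sm mulrDl.
  by have ? := sY _ Yb; have ? := mW1 _ W1b; sr.
have mW1U : minimal_ext W1 U.
  split=> // [|Z hZ W1Z ZU]; first by split=> // /(_ _ (YU _ Yb)).
  have [||E|E] := minY _ (subringI hZ hY).
  - by move=> x Xx; split; [apply/W1Z/XW1|exact: XY].
  - by move=> x [].
  - left; apply/seteqP; split=> // z Zz; have [w W1w [y Yy zE]] := ZU z Zz.
    have Xy : X y.
      rewrite -E; split=> //; rewrite -[y](addKr w) zE.
      by have ? := W1Z _ W1w; sr.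
    by rewrite -zE; have ? := XW1 _ Xy; sr.
  - right; apply/seteqP; split=> //; apply: sumset_sub => // y Yy.
    by have [] : (Z `&` Y) y by rewrite E.
have ntW1U : ~ t_closed W1 U.
  apply/not_t_closedP; exists b, r.
  by split=> //; [exact: YU|exact: XW1..].
have tW1W : t_closed W1 W.
  exact: t_closed_inert_up inW1 (power_integral_up RX) hW W1W tc.
have [||s1 [m1 [[W1s1 s1U] [W1m1 m1W] sm1]]] := IH W1 _ _ U mW1U ntW1U hW W1W tW1W.
- by split=> //; exact: subset_trans XW1.
- by split.
have Xmm1 : X (m * m1) by exact: mW1.
(* From [s + m = 1] and [s1 + m1 = 1]: [m] brings the two conductors relative to [W1] down to
   [X]. *)
exists (s + m * s1), (m * m1); split.
- split=> [|y Yy].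
    by have ? := mW1 _ W1s1; sr.
  have -> : (s + m * s1) * y = s * y + m * (s1 * y) by ring.
  by have ? := sY _ Yy; have ? := mW1 _ (s1U _ (YU _ Yy)); sr.
- split=> // w Ww; rewrite -mulrA; apply: mW1; exact: m1W.
- by rewrite -addrA -mulrDr sm1 mulr1.
Qed.

Hypothesis hT : is_subring T.
Hypothesis T_least : forall X, interm R T X -> t_closed X T -> X = T.

(** Climbs the other side of the grid: [X] grows to a non-inert minimal extension [X1] inside [T],
    and [W] to [W + X1], which stays t-closed over [X1]. *)
Lemma comax_t_closure X W : interm R T X -> is_subring W -> X `<=` W ->
  t_closed X W -> comax X T W.
Proof.
have fcp := proj1 cat.
move=> [hX RX XT]; have IX : interm R [set: A] X by split.
move: hX RX XT W; move: X IX; apply: (FCP_ind fcp) => X IX IH hX RX XT W hW XW tXW.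
have [ET|NT] := pselect (X = T).
  exists 1, 0; split; rewrite ?addr0//; last exact: conductor0.
  by split=> [|u]; rewrite -?ET ?mul1r//; sr.
have /not_t_closedP[b [r [Tb nXb Xr h2 h3]]] : ~ t_closed X T.
  by move=> tXT; apply/NT/T_least.
have Xbz z : X z -> X (z * (b ^+ 2 - r * b)) by move=> ?; sr.
have hY := @sumset_quadratic_subring _ X X b r hX hX (@subset_refl _ X) Xr Xbz.
set Y := sumset _ _ in hY.
have XY : X `<=` Y by apply: sumsetl; exists 0; [sr|rewrite mulr0].
have Yb : Y b by apply: sumsetr; [sr|exists 1; [sr|rewrite mulr1]].
have YT : Y `<=` T by apply: sumset_sub => // _ [x Xx <-]; have ? := XT _ Xx; sr.
have [||X1 mXX1 X1Y] := exists_minimal_ext fcp IX (U := Y).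
- by split=> //; exact: subset_trans XY.
- by split=> // /(_ _ Yb).
have [_ hX1 [XX1 nX1X] _] := mXX1.
(* Any element of [X1] outside [X] is [y + b * z]; then [b * z] satisfies the relations with [z * r]
   in place of [r]. *)
have ntX1 : ~ t_closed X X1.
  have [x X1x nXx] := minimal_ext_ex mXX1.
  have [y Xy [_ [z Xz <-] xE]] := X1Y x X1x.
  apply/not_t_closedP; exists (b * z), (z * r); split.
  - rewrite -[b * z](addKr y) xE; have ? := XX1 _ Xy; sr.
  - by move=> Xbz'; apply: nXx; rewrite -xE; sr.
  - by sr.
  - have -> : (b * z) ^+ 2 - z * r * (b * z) = z ^+ 2 * (b ^+ 2 - r * b) by ring.
    by sr.
  - have -> : (b * z) ^+ 3 - z * r * (b * z) ^+ 2 =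
      z ^+ 3 * (b ^+ 3 - r * b ^+ 2) by ring.
    by sr.
have cX1 := comax_minimal IX mXX1 ntX1 hW XW tXW.
have hU := comax_sumset_subring hX hX1 hW XX1 XW cX1.
have tU := comax_t_closed hX hX1 hW XX1 XW cX1 tXW.
have RX1 := subset_trans RX XX1; have X1T := subset_trans X1Y YT.
have X1U : X1 `<=` sumset W X1 by apply: sumsetr; sr.
have WU : W `<=` sumset W X1 by apply: sumsetl; sr.
have [//|//|s1 [m1 [[X1s1 s1T] [X1m1 m1U] sm1]]] :=
  IH X1 _ _ hX1 RX1 X1T _ hU X1U tU.
have [s [m [[Xs sX1] [Xm mW] sm]]] := cX1.
exists (s * s1), (m + s * m1); split.
- split=> [|u Tu]; first exact: sX1.
  by rewrite -mulrA; apply: sX1; exact: s1T.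
- split=> [|w Ww]; first by have ? := sX1 _ X1m1; sr.
  rewrite mulrDl -mulrA; have ? := mW _ Ww; have ? := sX1 _ (m1U _ (WU _ Ww)).
  by sr.
- by rewrite addrCA -mulrDr sm1 mulr1 addrC.
Qed.

End Comaximal.

(** * Residue field degrees *)

Section Dependence.
Variables (A : comPzRingType) (X P G : set A).
Hypothesis hX : is_subring X.
Hypothesis P_max : forall a, X a -> ~ P a -> exists2 w, X w & P (1 + a * w).
Hypothesis PM : forall a p, X a -> P p -> P (a * p).
Hypothesis P1 : ~ P 1.
Hypothesis GB : forall x y, G x -> G y -> G (x - y).
Hypothesis GM : forall a x, X a -> G x -> G (a * x).

(** Gaussian elimination over the field [X / P], on representatives and modulo the submodule [G]:
    more than [n] vectors in the span of [n] are dependent. *)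
Lemma linear_dependence (e : nat -> A) (m : nat) n (D : {set 'I_m})
    (f : 'I_m -> A) :
  (forall p j, P p -> G (p * e j)) -> (n < #|D|)%N ->
  (forall i, i \in D -> exists2 a : nat -> A, forall j, X (a j) &
     G (f i - \sum_(j < n) a j * e j)) ->
  exists c : 'I_m -> A, [/\ forall i, X (c i),
     exists2 i, i \in D & ~ P (c i) & G (\sum_(i in D) c i * f i)].
Proof.
move=> Pe; elim: n D f => [|n IH] D f nD hf.
  have [i iD] : exists i, i \in D by apply/set0Pn; rewrite -card_gt0.
  exists (fun j => (j == i)%:R); split.
  - by move=> j; case: eqP => _; rewrite ?mulr1n ?mulr0n; sr.
  - by exists i; rewrite ?eqxx.
  - rewrite (big_setD1 i)//= eqxx mul1r big1 => [|j].
      by have [a _] := hf i iD; rewrite big_ord0 subr0 addr0.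
    by rewrite in_setD1 => /andP[/negPf-> _]; rewrite mul0r.
have G0 : G 0.
  have [i iD] : exists i, i \in D by apply/set0Pn; rewrite -card_gt0 (leq_trans _ nD).
  have [a _ Ga] := hf i iD.
  by rewrite -(subrr (f i - \sum_(j < n.+1) a j * e j)); exact: GB.
have GD x y : G x -> G y -> G (x + y).
  move=> Gx Gy; have -> : x + y = x - (0 - y) by ring.
  by apply: (GB) => //; apply: (GB).
have /choice[a ha] i : exists b : nat -> A, i \in D ->
    (forall j, X (b j)) /\ G (f i - \sum_(j < n.+1) b j * e j).
  have [iD|_] := boolP (i \in D); last by exists (fun=> 0).
  by have [b ? ?] := hf i iD; exists b.
have [[i0 i0D nP0]|h] := pselect (exists2 i, i \in D & ~ P (a i n)); last first.
  apply: IH => [|i iD]; first exact: ltnW.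
  have [Xa Ga] := ha i iD; exists (a i) => //.
  have -> : f i - \sum_(j < n) a i j * e j =
      (f i - \sum_(j < n.+1) a i j * e j) + a i n * e n.
    by rewrite big_ord_recr /=; ring.
  apply: GD => //; apply: Pe; apply: contrapT => nP; apply: h; by exists i.
(* The row [i0] is the pivot; [- w] inverts its coefficient modulo [P], so adding [a i n * w] times
   it clears [e n] from row [i]. *)
have [Xa0 Ga0] := ha i0 i0D; have [w Xw Pw] := P_max (Xa0 n) nP0.
have [|i|c [Xc [i iD nPi] Gc]] :=
  IH (D :\ i0)%SET (fun i => f i + a i n * w * f i0).
- by rewrite (cardsD1 i0) i0D in nD.
- rewrite in_setD1 => /andP[_ iD]; have [Xa Ga] := ha i iD.
  exists (fun j => a i j + a i n * w * a i0 j) => [j|]; first by sr.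
  have -> : f i + a i n * w * f i0 -
        \sum_(j < n) (a i j + a i n * w * a i0 j) * e j =
      (f i - \sum_(j < n.+1) a i j * e j) +
      a i n * w * (f i0 - \sum_(j < n.+1) a i0 j * e j) +
      a i n * (1 + a i0 n * w) * e n.
    under eq_bigr => j _ do rewrite mulrDl -mulrA.
    by rewrite big_split /= -mulr_sumr !big_ord_recr /=; ring.
  by apply: (GD); [apply: (GD) => //; apply: GM; [sr|done]|apply/Pe/PM].
exists (fun i => if i == i0 then
  \sum_(i in (D :\ i0)%SET) c i * (a i n * w) else c i).
split.
- move=> j; case: eqP => // _; apply: subr_sum => // k.
  by rewrite in_setD1 => /andP[_ /ha[Xa _]]; sr.
- move: iD; rewrite in_setD1 => /andP[/negPf ii0 iD].
  by exists i; rewrite ?ii0.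
- rewrite (big_setD1 i0)//= eqxx mulr_suml -big_split /=.
  congr G: Gc; apply: eq_bigr => j; rewrite in_setD1 => /andP[/negPf-> _].
  by ring.
Qed.

End Dependence.

Section ResidueFields.
Variable A : comPzRingType.
Implicit Types (R S T U V W X Y Z P : set A) (a b r u v x y : A).

(** The least degree of a monic equation of [b] over [X]; for inert extensions, the degree of the
    minimal polynomial of the residue class. *)
Definition is_degree X b k : Prop :=
  power_span X b k (b ^+ k) /\ forall j, power_span X b j (b ^+ j) -> (k <= j)%N.

Lemma degree_ex X b k : power_span X b k (b ^+ k) -> exists d, is_degree X b d.
Proof.
move=> hk; have ex : exists n, `[< power_span X b n (b ^+ n) >].
  by exists k; apply/asboolP.
case: (ex_minnP ex) => d /asboolP hd dmin; exists d; split=> // j hj.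
by apply: dmin; apply/asboolP.
Qed.

(** A top coefficient outside the conductor could be normalised to 1, giving a monic equation of
    degree below [k]. *)
Lemma degree_independent X V b k (c : nat -> A) n :
  inert_ext X V -> power_integral X V ->
  V b -> is_degree X b k -> (n <= k)%N -> (forall i, X (c i)) ->
  conductor X V (\sum_(i < n) c i * b ^+ i) ->
  forall i, (i < n)%N -> conductor X V (c i).
Proof.
move=> [hm tc] hi Vb [hk kmin] nk Xc; elim: n nk => // n IH nk.
have [hX hV [XV _] _] := hm.
rewrite big_ord_recr /= => Ps.
have Pn : conductor X V (c n).
  apply: contrapT => nP; have [w Xw Pw] := conductor_maximal hm hi (Xc n) nP.
  case: n nk Ps nP Pw {IH} => [|n] nk Ps nP Pw.
    by apply: nP; move: Ps; rewrite big_ord0 add0r expr0 mulr1.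
  suff /kmin : power_span X b n.+1 (b ^+ n.+1) by rewrite leqNgt nk.
  set s := \sum_(i < n.+1) c i * b ^+ i in Ps.
  have -> : b ^+ n.+1 = ((1 + c n.+1 * w) * b ^+ n.+1 -
      w * (s + c n.+1 * b ^+ n.+1)) + w * s by ring.
  have spanX x : X x -> power_span X b n.+1 x.
    by move=> Xx; rewrite -[x]mulr1 -(expr0 b); apply: spanZ => //; exact: span_pow.
  apply: spanD => //; last by apply: spanZ => //; exists c.
  apply: spanX; apply: subr_B => //.
    by have [_] := Pw; apply; sr.
  by have [Xs _] := Ps; sr.
have Pnb : conductor X V (c n * b ^+ n) by apply: conductorM => //; sr.
move=> i; rewrite ltnS leq_eqVlt => /orP[/eqP->//|]; apply: IH; first exact: ltnW.
by rewrite -[X in conductor _ _ X](addrK (c n * b ^+ n)); apply: conductorB.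
Qed.

(* The elements [d^i b] for [i < l] lie in [U + V], which modulo [V] is       *)
(* spanned by [b, ..., b^(k-1)]; if [k <= l] they are dependent modulo [V].   *)
Lemma inert_degree_lt X U V b d k l :
  inert_ext X U -> inert_ext X V -> power_integral X U -> power_integral X V ->
  (forall x, conductor X U x <-> conductor X V x) -> U `&` V `<=` X ->
  is_subring (sumset U V) -> U b -> ~ X b -> V d -> ~ X d ->
  is_degree X b k -> is_degree X d l -> (l < k)%N.
Proof.
move=> inU inV iU iV UVE UIV hB Ub nXb Vd nXd degb degd.
have [[hmU tU] [hmV tV]] := (inU, inV).
have [hX hU [XU _] _] := hmU; have [_ hV [XV _] _] := hmV.
have UE := minimal_ext_span hX (proj1 degb) hmU Ub nXb.
rewrite ltnNge; apply/negP => kl.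
(* Degree 0 would make [U] the zero set, contained in [X]. *)
case: k degb kl UE => [|k] degb kl UE.
  have Xz x : U x -> X x by rewrite -UE => -[c _ ->]; rewrite big_ord0; sr.
  by apply: nXb; exact: Xz.
have nP1 : ~ conductor X U 1 by exact: minimal_ext_nonconductor1 hmU.
have [||||p j Pp|||c [Xc [i0 _ nPi0] Vc]] :=
  @linear_dependence A X (conductor X U) V hX _ _ nP1 _ _ (fun j => b ^+ j.+1) l k [set: 'I_l]%SET (fun i => d ^+ i * b).
- by move=> a Xa; exact: (conductor_maximal hmU iU).
- by move=> a p Xa; move/conductorMl; apply=> //; exact: XU.
- by move=> x y Vx Vy; sr.
- by move=> x y /XV Vx Vy; sr.
- by apply: XV; have [_] := Pp; apply; sr.
- by rewrite cardsT card_ord.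
- move=> i _; have : sumset U V (d ^+ i * b).
    apply: subr_M => //; first by apply: sumsetr; [sr|sr].
    by apply: sumsetl; [sr|].
  (* The constant term [c 0] is absorbed by [V]; this saves one generator and makes the inequality
     strict. *)
  rewrite -{1}UE => -[_ [c Xc ->] [v Vv vE]].
  exists (fun j => c j.+1) => [j|]; first by [].
  have sE : \sum_(i < k.+1) c i * b ^+ i = c 0%N + \sum_(j < k) c j.+1 * b ^+ j.+1.
    by rewrite big_ord_recl expr0 mulr1.
  rewrite -vE sE; set t := \sum_(j < k) _.
  have -> : c 0%N + t + v - t = c 0%N + v by ring.
  by have ? := XV _ (Xc 0%N); sr.
set K := \sum_(i < l) c i * d ^+ i.
have VK : V K.
  by apply: subr_sum => // i _; have ? := XV _ (Xc i); sr.
have VKb : V (K * b).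
  congr V: Vc; rewrite /K mulr_suml; apply: eq_big => [i|i _]; first by rewrite inE.
  by rewrite mulrA.
(* If [K] were invertible modulo the conductor, [K * b] in [V] would put [b] in [U & V], hence in
   [X]. *)
have [PK|nPK] := pselect (conductor X V K); last first.
  have [v Vv Pv] := inert_unit inV iV VK nPK.
  have [_ Pvb] := iffRL (UVE _) Pv.
  apply: nXb; apply: UIV; split=> //.
  have -> : b = v * (K * b) - (K * v - 1) * b by ring.
  by have ? := XV _ (Pvb _ Ub); sr.
apply: nPi0; apply/UVE.
have Xc' (i : nat) : X (if insub i is Some j then c j else 0).
  by case: insubP => // _; sr.
have := @degree_independent X V d l _ l inV iV Vd degd (leqnn l) Xc' _
  i0 (ltn_ord i0).
rewrite valK; apply.
by under eq_bigr => i _ do rewrite valK.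
Qed.

(** If [U & V] were [X], [inert_degree_lt] used both ways would give [l < k] and [k < l]. *)
Lemma inert_ext_eq X U V : inert_ext X U -> inert_ext X V ->
  power_integral X U -> power_integral X V ->
  (forall x, conductor X U x <-> conductor X V x) ->
  is_subring (sumset U V) -> U = V.
Proof.
move=> inU inV iU iV UVE hB.
have [[hmU _] [hmV _]] := (inU, inV).
have [hX hU [XU _] minU] := hmU; have [_ hV [XV nVX] minV] := hmV.
have [||E|E] := minU _ (subringI hU hV).
- by move=> x Xx; split; [exact: XU|exact: XV].
- by move=> x [].
- exfalso.
  have [b Ub nXb] := minimal_ext_ex hmU; have [d Vd nXd] := minimal_ext_ex hmV.
  have [_ /degree_ex[k degb]] := iU b Ub; have [_ /degree_ex[l degd]] := iV d Vd.
  have lk : (l < k)%N.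
    apply: inert_degree_lt inU inV iU iV UVE _ hB Ub nXb Vd nXd degb degd.
    by rewrite E.
  have : (k < l)%N.
    apply: inert_degree_lt inV inU iV iU _ _ _ Vd nXd Ub nXb degd degb.
    + by move=> x; split=> /UVE.
    + by rewrite setIC E.
    + by rewrite sumsetC.
  by move=> /(ltn_trans lk); rewrite ltnn.
have UV : U `<=` V by rewrite -E => x [].
have [EX|//] := minV U hU XU UV.
by exfalso; have [b Ub] := minimal_ext_ex hmU; rewrite EX in Ub; apply.
Qed.

(** * Local comparability above a t-closed ring *)

Variable R : set A.
Hypothesis fcp : FCP R [set: A].
Hypothesis int : power_integral R [set: A].

Lemma t_closed_up X Z U : interm R [set: A] X -> is_subring Z -> is_subring U ->
  X `<=` Z -> Z `<=` U -> t_closed X U -> t_closed Z U.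
Proof.
move=> IX hZ hU XZ ZU; move: X IX XZ; apply: (FCP_ind fcp) => X IX IH XZ tc.
have [ZX|nZX] := pselect (Z `<=` X).
  by have <- : X = Z by apply/seteqP.
have IZ : interm R [set: A] Z.
  by split=> //; have [_ RX _] := IX; exact: subset_trans XZ.
have [//|X1 mXX1 X1Z] := exists_minimal_ext fcp IX IZ.
have [_ hX1 XX1 _] := mXX1; have [_ RX _] := IX.
have inX1 : inert_ext X X1.
  by split=> //; apply: t_closed_subset tc; exact: subset_trans ZU.
apply: (IH X1) => //.
- by split=> //; case: XX1 => + _; exact: subset_trans.
- apply: (t_closed_inert_up inX1 (power_integral_up int RX)) => //.
  exact: subset_trans ZU.
Qed.

(* Let [Z] be maximal in [[X, U]] with [s Z <= X] for some [s] outside [P],   *)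
(* and [Z < Z2] minimal in [[Z, U]]: the desired extension is found inside    *)
(* [X + s Z2].                                                                *)
Lemma prime_inert_ext X U P : interm R [set: A] X -> is_subring U -> X `<=` U ->
  t_closed X U -> prime_ideal X P -> (forall s, conductor X U s -> P s) ->
  exists U1, [/\ inert_ext X U1, U1 `<=` U & forall x, conductor X U1 x <-> P x].
Proof.
move=> IX hU XU tc hP colP; have [hX RX _] := IX.
pose F : set (set A) := [set Z | [/\ is_subring Z, X `<=` Z, Z `<=` U &
  exists2 s, conductor X Z s & ~ P s]].
have [||[Z [hZ XZ ZU [s [Xs sZ] nPs]] Zmax] _] :=
  @FCP_extremal A R [set: A] F X fcp.
- by move=> Z [hZ XZ _ _]; split=> //; exact: subset_trans XZ.
- split=> //; exists 1; last exact: (prime_ideal1 hP).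
  by split=> [|x Xx]; rewrite ?mul1r//; sr.
have RZ := subset_trans RX XZ.
have [UZ|nUZ] := pselect (U `<=` Z).
  by exfalso; apply/nPs/colP; split=> // u /UZ; exact: sZ.
have IZ : interm R [set: A] Z by split.
have IU : interm R [set: A] U by split=> //; exact: subset_trans ZU.
have [//|Z2 mZZ2 Z2U] := exists_minimal_ext fcp IZ IU.
have [_ hZ2 [ZZ2 nZ2Z] _] := mZZ2.
pose N := conductor Z Z2.
have XZ2 := subset_trans XZ ZZ2.
have nFZ2 t : conductor X Z2 t -> P t.
  move=> ht; apply: contrapT => nPt; apply: nZ2Z; rewrite (Zmax Z2)//.
  by split=> //; exists t.
(* [s * n] multiplies [Z2] into [s * Z], hence into [X]; it lies in [P] by maximality of [Z], and
   [s] does not. *)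
have NP n : N n -> X n -> P n.
  move=> [_ nZ2] Xn; have : P (s * n).
    apply: nFZ2; split=> [|z Z2z]; first by sr.
    by rewrite -mulrA; apply: sZ; exact: nZ2.
  by move=> /(prime_ideal_prime hP Xs Xn)[].
have PX p : P p -> X p by move=> Pp; exact: (prime_ideal_sub hP Pp).
have PM x p : X x -> P p -> P (x * p).
  by move=> Xx Pp; exact: (prime_idealM hP Xx Pp).
have PB x y : P x -> P y -> P (x - y).
  move=> Px Py; apply: (prime_idealD hP) => //.
  by rewrite -mulN1r; apply: PM => //; sr.
have nP1 := prime_ideal1 hP.
have maxN := conductor_maximal mZZ2 (power_integral_up int RZ).
(* Inverting [y * s] rather than [y] in [Z / N] yields an inverse [s * z] that lies in [X]. *)
have inv y : X y -> ~ N y -> exists2 w, X w & N (1 + y * w).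
  move=> Xy nNy; have nNys : ~ N (y * s).
    move=> Nys; have [z Zz Nz] := maxN y (XZ _ Xy) nNy.
    apply/nPs/NP => //; have -> : s = s * (1 + y * z) - y * s * z by ring.
    by apply: conductorB => //; [apply: conductorMl|apply: conductorM] => //; sr.
  have [|z Zz Nz] := maxN (y * s) _ nNys; first by sr.
  by exists (s * z); [exact: sZ|rewrite mulrA].
have PN p : P p -> N p.
  move=> Pp; apply: contrapT => nNp; have [w Xw Nw] := inv p (PX _ Pp) nNp.
  have Xp := PX _ Pp; apply: nP1; have -> : 1 = (1 + p * w) - w * p by ring.
  by apply: PB; [apply: NP => //; sr|exact: PM].
have hY : is_subring (sumset X (multiples s Z2)).
  by apply: sumset_multiples_subring => //; sr.
have XY : X `<=` sumset X (multiples s Z2).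
  by apply: sumsetl; exists 0; [sr|rewrite mulr0].
have YU : sumset X (multiples s Z2) `<=` U.
  by apply: sumset_sub => // _ [z Z2z <-]; sr.
have [||U1 mXU1 U1Y] := exists_minimal_ext fcp IX (U := sumset X (multiples s Z2)).
- by split=> //; exact: subset_trans XY.
- split=> // YX; apply/nPs/nFZ2; split=> // z Z2z; apply: YX.
  by apply: sumsetr; [sr|exact: multiplesI].
have [_ hU1 [XU1 _] _] := mXU1.
have colU1 p : P p -> conductor X U1 p.
  move=> Pp; split=> [|u /U1Y[x Xx [_ [z Z2z <-] <-]]]; first exact: PX.
  have Xp := PX _ Pp; have [_ pZ2] := PN _ Pp.
  have -> : p * (x + s * z) = p * x + s * (p * z) by ring.
  by have ? := sZ _ (pZ2 _ Z2z); sr.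
exists U1; split.
- by split=> //; apply: t_closed_subset tc; exact: subset_trans YU.
- exact: subset_trans YU.
- move=> q; split=> [[Xq qU1]|/colU1//].
  apply: contrapT => nPq; have [|w Xw Nw] := inv q Xq.
    by move=> Nq; apply/nPq/NP.
  apply: (minimal_ext_nonconductor1 mXU1).
  have -> : 1 = (1 + q * w) - q * w by ring.
  apply: conductorB => //; first by apply: colU1; apply: NP => //; sr.
  by apply: conductorM => //; exact: XU1.
Qed.

Lemma conductor_prime X U P : inert_ext X U -> power_integral X U ->
  (forall x, conductor X U x <-> P x) -> prime_ideal U P.
Proof.
move=> inU iU PE; have [[hX hU [XU _] _] _] := inU.
split=> //.
- by move=> x /PE[/XU].
- by apply/PE/conductor0.
- by move=> x y /PE Px /PE Py; apply/PE/conductorD.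
- by move=> r x Ur /PE Px; apply/PE/conductorMl.
- by move/PE; apply: minimal_ext_nonconductor1; case: inU.
- move=> x y Ux Uy /PE Pxy; apply: contrapT => /not_orP[nPx nPy].
  have [|v Uv Pv] := inert_unit inU iU Ux; first by move/PE.
  apply/nPy/PE; have -> : y = x * y * v - (x * v - 1) * y by ring.
  by apply: conductorB => //; exact: conductorM.
Qed.

(** Either a conductor [(X : U)] or [(X : V)] leaves [P] and gives [s], or [U] and [V] contain a
    common inert step [U1] with conductor [P], in which [P] is again prime, and the induction
    continues there. *)
Lemma Delta_locally_comparable X U V P x y :
  interm R [set: A] X -> t_closed X [set: A] -> prime_ideal X P ->
  interm X [set: A] U -> interm X [set: A] V ->
  (forall U' V', interm X [set: A] U' -> interm X [set: A] V' ->
     is_subring (sumset U' V')) ->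
  U x -> V y -> (exists s, [/\ X s, ~ P s & V (s * x) \/ U (s * y)]).
Proof.
move=> IX; move: X IX P; apply: (FCP_ind fcp) => X IX IH P tc hP.
move=> [hU XU _] [hV XV _] Delta Ux Vy; apply: contrapT => nex.
have [hX RX _] := IX; have iX W := @power_integral_up A R int X W RX.
have tsub W : t_closed X W by exact: t_closed_subset tc.
have [s [Xs sU]|U1 [inU1 U1U PU1]] := prime_inert_ext IX hU XU (tsub U) hP.
  apply: contrapT => nPs; apply: nex; exists s; split=> //; left.
  exact/XV/sU.
have [s [Xs sV]|V1 [inV1 V1V PV1]] := prime_inert_ext IX hV XV (tsub V) hP.
  apply: contrapT => nPs; apply: nex; exists s; split=> //; right.
  exact/XU/sV.
have [[mXU1 _] [mXV1 _]] := (inU1, inV1).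
have [_ hU1 [XU1 nU1X] _] := mXU1; have [_ hV1 [XV1 _] _] := mXV1.
have E : U1 = V1.
  apply: (inert_ext_eq inU1 inV1) => //; last by apply: Delta.
  by move=> z; rewrite PU1 PV1.
have RU1 := subset_trans RX XU1.
have [|||||||||s [U1s nPs]] := IH U1 _ _ P.
- by split.
- by split.
- by apply: (t_closed_up IX hU1 _ XU1 _ tc) => //; exact: subringT.
- exact: (conductor_prime inU1).
- by split.
- by split=> //; rewrite E.
- move=> U' V' [? ? ?] [? ? ?].
  by apply: Delta; split=> //; exact: subset_trans XU1 _.
- by [].
- by [].
(* The multiplier [s] found lies only in [U1]; [s * v], congruent to 1 modulo [P], lies in [X] and
   outside [P]. *)
have [|v U1v Pv] := inert_unit inU1 (iX _) U1s; first by move/PU1.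
have [Xsv _] := Pv; have Xsv' : X (s * v) by rewrite -[s * v](subrK 1); sr.
move=> h; apply: nex; exists (s * v); split=> //.
  move=> Psv; apply: (minimal_ext_nonconductor1 mXU1).
  by rewrite -[1](subKr (s * v)); apply: conductorB => //; apply/PU1.
have Uv := U1U _ U1v; have Vv : V v by apply: V1V; rewrite -E.
have -> : s * v * x = v * (s * x) by ring.
have -> : s * v * y = v * (s * y) by ring.
by case: h => h; [left|right]; sr.
Qed.

End ResidueFields.

(** * Localization and arithmetic extensions *)

Section PrimeIdeals.
Variables (A : comPzRingType) (T : set A).
Hypothesis hT : is_subring T.

Definition ideal (J : set A) : Prop :=
  [/\ J `<=` T, J 0, forall x y, J x -> J y -> J (x + y) &
      forall r x, T r -> J x -> J (r * x)].

Lemma exists_prime_ideal J : ideal J -> ~ J 1 ->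
  exists2 P, prime_ideal T P & J `<=` P.
Proof.
move=> [JT J0 JD JM] nJ1.
pose Q : set (set A) := [set X | ideal (X `|` J) /\ ~ (X `|` J) 1].
have [F FQ tF|M [[[MT M0 MD MM] nM1] Mmax]] := @Zorn_bigcup _ Q.
  split; last by move=> [[X FX X1]|//]; have [_] := FQ _ FX; apply; left.
  split.
  - by move=> x [[X FX Xx]|/JT//]; have [[XT _ _ _] _] := FQ _ FX; apply: XT; left.
  - by right.
  - have D X x y : F X -> (X `|` J) x -> (X `|` J) y ->
        (\bigcup_(X in F) X `|` J) (x + y).
      move=> FX Xx Xy; have [[_ _ XD _] _] := FQ _ FX.
      by case: (XD _ _ Xx Xy) => [?|?]; [left; exists X|right].
    move=> x y [[X FX Xx]|Jx] [[Y FY Yy]|Jy].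
    + have [XY|YX] := tF _ _ FX FY.
        by apply: (D Y) => //; left => //; exact: XY.
      by apply: (D X) => //; left => //; exact: YX.
    + by apply: (D X) => //; [left|right].
    + by apply: (D Y) => //; [right|left].
    + by right; exact: JD.
  - move=> r x Tr [[X FX Xx]|Jx]; last by right; exact: JM.
    have [[_ _ _ XM] _] := FQ _ FX.
    by case: (XM r x Tr (or_introl Xx)) => [?|?]; [left; exists X|right].
set P := M `|` J in MT M0 MD MM nM1.
exists P; last by move=> x; right.
split=> // x y Tx Ty Pxy; apply: contrapT => /not_orP[nPx nPy].
pose N : set A := [set p + x * t | p in P & t in T].
have PN : P `<=` N by move=> p Pp; exists p => //; exists 0; [sr|ring].
have NJ : N `|` J = N by apply/setUidPl => z Jz; apply: PN; right.
apply: (Mmax N).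
  split=> [z Mz|NM]; first by apply: PN; left.
  by apply: nPx; left; apply: NM; exists 0 => //; exists 1; [sr|ring].
change (ideal (N `|` J) /\ ~ (N `|` J) 1); rewrite NJ; split; last first.
  move=> [p Pp [t Tt pt]]; apply: nPy.
  have -> : y = y * p + t * (x * y).
    by transitivity (y * (p + x * t)); [rewrite pt mulr1|ring].
  by apply: (MD); apply: MM.
split.
- by move=> _ [p /MT Tp [t Tt <-]]; sr.
- exact: PN.
- move=> _ _ [p Pp [t Tt <-]] [q Pq [u Tu <-]].
  by exists (p + q); [exact: MD|exists (t + u); [sr|ring]].
- move=> r _ Tr [p Pp [t Tt <-]].
  by exists (r * p); [exact: MM|exists (r * t); [sr|ring]].
Qed.

End PrimeIdeals.

Section LocalizedSubrings.
Variables (A : comPzRingType) (D : mult_set A).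
Local Notation type := (Localization.type D).
Local Notation frac := (@Localization.frac A D).
Local Notation den1 := (Localization.den1 D).
Local Notation dval := (@Localization.dval A D).
Implicit Types (T U : set A) (W : set type).

Lemma fracM a s b t : frac a s * frac b t = frac (a * b) (Localization.denM s t).
Proof. exact: Localization.frac_mul. Qed.

Lemma fracB a s b t :
  frac a s - frac b t = frac (a * dval t - b * dval s) (Localization.denM s t).
Proof.
transitivity (Localization.add (frac a s) (Localization.opp (frac b t))).
  by [].
by rewrite Localization.frac_opp Localization.frac_add mulNr.
Qed.

Lemma frac_den1 a s : frac a s = frac a den1 * frac 1 s.
Proof.
rewrite fracM; apply/Localization.frac_eq; exists den1.
by rewrite !Localization.valE; ring.
Qed.

Lemma frac_cancel a s : frac a s * frac (dval s) den1 = frac a den1.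
Proof.
rewrite fracM; apply/Localization.frac_eq; exists den1.
by rewrite !Localization.valE; ring.
Qed.

Lemma loc_sub_subring T : is_subring T -> D `<=` T -> is_subring (loc_sub D T).
Proof.
move=> hT DT; have Tdval s : T (dval s).
  by apply: DT; have := valP s; rewrite inE.
apply/is_subringP; split.
- by exists 1; [sr|exists den1].
- move=> _ _ [a Ta [s ->]] [b Tb [t ->]]; rewrite fracB.
  by exists (a * dval t - b * dval s); [sr|exists (Localization.denM s t)].
- move=> _ _ [a Ta [s ->]] [b Tb [t ->]]; rewrite fracM.
  by exists (a * b); [sr|exists (Localization.denM s t)].
Qed.

Lemma loc_sub_mono T U : T `<=` U -> loc_sub D T `<=` loc_sub D U.
Proof. by move=> TU _ [a /TU Ua [s ->]]; exists a => //; exists s. Qed.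

Definition contraction W : set A := [set a | W (frac a den1)].

Lemma contraction_subring W : is_subring W -> is_subring (contraction W).
Proof.
move=> hW; apply/is_subringP; split.
- exact: (subr_1 hW).
- move=> x y Wx Wy; have := subr_B hW Wx Wy; rewrite fracB /contraction /=.
  congr W; apply/Localization.frac_eq; exists den1.
  by rewrite !Localization.valE; ring.
- move=> x y Wx Wy; have := subr_M hW Wx Wy; rewrite fracM /contraction /=.
  congr W; apply/Localization.frac_eq; exists den1.
  by rewrite !Localization.valE; ring.
Qed.

End LocalizedSubrings.

Section Arithmetic.
Variables (A : comPzRingType) (T : set A).
Hypothesis hT : is_subring T.

(** At a prime [P] containing the ideal [J] of multipliers, comparability gives [t] outside [P] with
    [t * u] in [V] or [t * v] in [U]; then [t] is in [J]. *)
Lemma arithmetic_Delta : arithmetic T [set: A] -> Delta_extension T [set: A].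
Proof.
move=> ar U V [hU TU _] [hV TV _]; rewrite -/(sumset U V).
have US : U `<=` sumset U V by apply: sumsetl; sr.
have VS : V `<=` sumset U V by apply: sumsetr; sr.
have SD x y : sumset U V x -> sumset U V y -> sumset U V (x + y).
  move=> [u Uu [v Vv <-]] [u' Uu' [v' Vv' <-]].
  have -> : u + v + (u' + v') = (u + u') + (v + v') by ring.
  by apply: sumsetI; sr.
have ST r x : T r -> sumset U V x -> sumset U V (r * x).
  move=> Tr [u Uu [v Vv <-]]; rewrite mulrDr.
  have ? := TU _ Tr; have ? := TV _ Tr.
  by apply: sumsetI; sr.
suff prod u v : U u -> V v -> sumset U V (u * v).
  split=> //; last exact: subset_trans US.
  apply/is_subringP; split; first by apply: US; sr.
    move=> x y Sx Sy; apply: SD => //; rewrite -mulN1r; apply: ST => //; sr.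
  move=> _ _ [u Uu [v Vv <-]] [u' Uu' [v' Vv' <-]].
  have -> : (u + v) * (u' + v') = (u * u' + v * v') + (u * v' + u' * v) by ring.
  apply: (SD); first by apply: sumsetI; sr.
  by apply: SD; exact: prod.
move=> Uu Vv; pose J : set A := [set s | T s /\ sumset U V (s * (u * v))].
suff [_] : J 1 by rewrite mul1r.
apply: contrapT => nJ1.
have [|P hP JP] := exists_prime_ideal hT _ nJ1 (J := J).
  split.
  - by move=> s [].
  - by split; [sr|rewrite mul0r; apply: US; sr].
  - by move=> s t [Ts hs] [Tt ht]; split; [sr|rewrite mulrDl; exact: SD].
  - by move=> r s Tr [Ts hs]; split; [sr|rewrite -mulrA; exact: ST].
pose D := prime_compl hP.
have DT : D `<=` T by move=> x [].
have loc W : is_subring W -> T `<=` W ->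
    interm (loc_sub D T) (loc_sub D [set: A]) (loc_sub D W).
  move=> hW TW; split; [|exact: loc_sub_mono..].
  by apply: loc_sub_subring => //; exact: subset_trans TW.
have cmp (W : set A) x : is_subring W -> T `<=` W ->
    loc_sub D W (Localization.frac x (Localization.den1 D)) ->
    exists t, [/\ T t, ~ P t & W (t * x)].
  move=> hW TW [b Wb [s /Localization.frac_eq[t]]].
  have Ds : mult_carrier D (Localization.dval s) by have := valP s; rewrite inE.
  have Dt : mult_carrier D (Localization.dval t) by have := valP t; rewrite inE.
  rewrite Localization.val_den1 mulr1 => E.
  exists (Localization.dval t * Localization.dval s).
  have [Ts nPs] := Ds; have [Tt nPt] := Dt; split; first by sr.
    by move=> /(prime_ideal_prime hP Tt Ts)[].
  by rewrite mulrAC -mulrA E; have ? := TW _ Tt; sr.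
have in_loc W x : W x -> loc_sub D W (Localization.frac x (Localization.den1 D)).
  by move=> Wx; exists x => //; exists (Localization.den1 D).
have [UV|VU] := ar P hP _ _ (loc U hU TU) (loc V hV TV).
- have [t [Tt nPt Vtu]] := cmp V u hV TV (UV _ (in_loc U u Uu)).
  by apply/nPt/JP; split=> //; rewrite mulrA; apply: VS; sr.
- have [t [Tt nPt Utv]] := cmp U v hU TU (VU _ (in_loc V v Vv)).
  by apply/nPt/JP; split=> //; rewrite mulrCA; apply: US; sr.
Qed.

Variable R : set A.
Hypothesis fcp : FCP R [set: A].
Hypothesis int : power_integral R [set: A].

Lemma Delta_arithmetic : R `<=` T -> t_closed T [set: A] ->
  Delta_extension T [set: A] -> arithmetic T [set: A].
Proof.
move=> RT tc Delta P hP; set D := prime_compl hP; move=> U V.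
move=> [hU TU _] [hV TV _]; apply: contrapT => /not_orP[nUV nVU].
(* The numerator of a fraction in [W] but not in [W']: elements outside [P] become units, so no such
   multiple falls into [W']. *)
have contr W W' : ~ W `<=` W' -> is_subring W -> is_subring W' ->
    loc_sub D T `<=` W -> loc_sub D T `<=` W' ->
    exists2 x, contraction W x & forall s, T s -> ~ P s -> ~ contraction W' (s * x).
  move=> nWW' hW hW' TW TW'.
  have [w Ww nW'w] : exists2 w, W w & ~ W' w.
    apply: contrapT => nex; apply: nWW' => w Ww; apply: contrapT => nW'w.
    by apply: nex; exists w.
  have [x [s wE]] := Localization.fracP w.
  exists x.
    rewrite /contraction /= -(frac_cancel x s) -wE; apply: subr_M => //.
    apply: TW; exists (Localization.dval s); last by exists (Localization.den1 D).
    by have := valP s; rewrite inE => -[].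
  move=> t Tt nPt W'tx; apply: nW'w.
  have Dt : t \in mult_carrier D by rewrite inE.
  have -> : w = Localization.frac (t * x) (Localization.den1 D) *
      Localization.frac 1 (Localization.denM (exist _ t Dt) s).
    rewrite wE -frac_den1; apply/Localization.frac_eq; exists (Localization.den1 D).
    by rewrite !Localization.valE /Localization.dval /=; ring.
  apply: subr_M => //; apply: TW'; exists 1; first by sr.
  by exists (Localization.denM (exist _ t Dt) s).
have sub W : is_subring W -> loc_sub D T `<=` W -> interm T [set: A] (contraction W).
  move=> hW TW; split=> //; first exact: contraction_subring.
  by move=> t Tt; apply: TW; exists t => //; exists (Localization.den1 D).
have [x Ux nVx] := contr U V nUV hU hV TU TV.
have [y Vy nUy] := contr V U nVU hV hU TV TU.
have [||s [Ts nPs [Vsx|Usy]]] := @Delta_locally_comparable A R fcp int T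
  (contraction U) (contraction V) P x y _ tc hP (sub U hU TU) (sub V hV TV) _ Ux Vy.
- by split.
- by move=> U' V' IU' IV'; have [] := Delta U' V' IU' IV'.
- exact: nVx Vsx.
- exact: nUy Usy.
Qed.

End Arithmetic.

(** * The t-closure *)

Section TClosureDelta.
Variables (A : comPzRingType) (R T : set A).
Hypothesis cat : catenarian R [set: A].
Hypothesis int : power_integral R [set: A].
Hypothesis IT : interm R [set: A] T.
Hypothesis tc : t_closed T [set: A].
Hypothesis T_least : forall X, interm R T X -> t_closed X T -> X = T.

(** Comaximality makes [U + T] and [V + T] rings, and [Delta] over [T] makes their sum a ring
    containing [u * v]. Over [Y = U0 + V0], [s] in [(Y : T)] brings the [T] part of [u * v] down to
    [Y], and [m] in [(Y : U + Y)] brings [u] down to [Y]. *)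
Lemma Delta_glue : Delta_extension R T -> Delta_extension T [set: A] ->
  Delta_extension R [set: A].
Proof.
move=> DRT DTS U V [hU RU _] [hV RV _]; rewrite -/(sumset U V).
have [hT RT _] := IT.
have IX W : is_subring W -> R `<=` W -> interm R T (W `&` T).
  move=> hW RW; split; first exact: subringI.
    by move=> x Rx; split; [exact: RW|exact: RT].
  by move=> x [].
have tX W : t_closed (W `&` T) W.
  move=> b r Wb [Wr Tr] [_ h2] [_ h3]; split=> //.
  exact: (tc (b := b) (r := r)).
set U0 := U `&` T; set V0 := V `&` T.
have [hU0 RU0 U0T] := IX U hU RU; have [hV0 RV0 V0T] := IX V hV RV.
have U0U : U0 `<=` U by move=> x [].
have V0V : V0 `<=` V by move=> x [].
have [hY RY YT] := DRT _ _ (IX U hU RU) (IX V hV RV).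
rewrite -/(sumset U0 V0) in hY RY YT; set Y := sumset U0 V0 in hY RY YT.
have U0Y : U0 `<=` Y by apply: sumsetl; sr.
have V0Y : V0 `<=` Y by apply: sumsetr; sr.
have cU := comax_t_closure cat int hT T_least (IX U hU RU) hU U0U (tX U).
have cV := comax_t_closure cat int hT T_least (IX V hV RV) hV V0V (tX V).
have hTU := comax_sumset_subring hU0 hT hU U0T U0U cU.
have hTV := comax_sumset_subring hV0 hT hV V0T V0V cV.
have comaxS (X X' Z W : set A) : X' `<=` Z -> comax X Z W -> comax X X' W.
  move=> X'Z [s [m [[Xs sZ] ? ?]]]; exists s, m; split=> //.
  by split=> // u /X'Z; exact: sZ.
have cUY := comaxS _ _ _ _ YT cU; have cVY := comaxS _ _ _ _ YT cV.
have hU' := comax_sumset_subring hU0 hY hU U0Y U0U cUY.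
have hV' := comax_sumset_subring hV0 hY hV V0Y V0V cVY.
have tU' := comax_t_closed hU0 hY hU U0Y U0U cUY (tX U).
set U' := sumset U Y in hU' tU'; set V' := sumset V Y in hV'.
have UU' : U `<=` U' by apply: sumsetl; sr.
have YU' : Y `<=` U' by apply: sumsetr; sr.
have VV' : V `<=` V' by apply: sumsetl; sr.
have YV' : Y `<=` V' by apply: sumsetr; sr.
have US : U `<=` sumset U V by apply: sumsetl; sr.
have VS : V `<=` sumset U V by apply: sumsetr; sr.
have SD x y : sumset U V x -> sumset U V y -> sumset U V (x + y).
  move=> [u Uu [v Vv <-]] [u' Uu' [v' Vv' <-]].
  have -> : u + v + (u' + v') = (u + u') + (v + v') by ring.
  by apply: sumsetI; sr.
have YS : Y `<=` sumset U V.
  by move=> _ [u /U0U Uu [v /V0V Vv <-]]; exact: sumsetI.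
have U'S : U' `<=` sumset U V.
  by move=> _ [u Uu [y Yy <-]]; apply: SD; [exact: US|exact: YS].
have V'S : V' `<=` sumset U V.
  by move=> _ [u Uu [y Yy <-]]; apply: SD; [exact: VS|exact: YS].
have IY : interm R T Y by split.
have [s [m [[Ys sT] [Ym mU'] sm]]] :=
  comax_t_closure cat int hT T_least IY hU' YU' tU'.
have ITU : interm T [set: A] (sumset U T) by split=> //; apply: sumsetr; sr.
have ITV : interm T [set: A] (sumset V T) by split=> //; apply: sumsetr; sr.
have [hB _ _] := DTS _ _ ITU ITV; rewrite -/(sumset _ _) in hB.
have prod u v : U u -> V v -> sumset U V (u * v).
  move=> Uu Vv; have : sumset (sumset U T) (sumset V T) (u * v).
    apply: subr_M => //.
      by apply: sumsetl; [apply: sumsetl; sr|apply: sumsetl; sr].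
    by apply: sumsetr; [apply: sumsetl; sr|apply: sumsetl; sr].
  move=> [_ [u1 Uu1 [t Tt <-]] [_ [v1 Vv1 [t' Tt' <-]] uvE]].
  have -> : u * v = s * (u * v) + m * u * v by rewrite -mulrA -mulrDl sm mul1r.
  rewrite -uvE.
  have -> : s * (u1 + t + (v1 + t')) + m * u * v =
    (s * u1 + s * v1) + (s * (t + t') + m * u * v) by ring.
  have Tt2 : T (t + t') by sr.
  have ? := YU' _ Ys; have ? := YV' _ Ys.
  apply: (SD); first by apply: (SD); [apply: U'S|apply: V'S]; sr.
  apply: (SD); first exact/YS/sT.
  by apply: V'S; have ? := YV' _ (mU' _ (UU' _ Uu)); sr.
split=> //; last exact: subset_trans US.
apply/is_subringP; split; first by apply: US; sr.
  move=> _ _ [u Uu [v Vv <-]] [u' Uu' [v' Vv' <-]].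
  have -> : u + v - (u' + v') = (u - u') + (v - v') by ring.
  by apply: sumsetI; sr.
move=> _ _ [u Uu [v Vv <-]] [u' Uu' [v' Vv' <-]].
have -> : (u + v) * (u' + v') = (u * u' + v * v') + (u * v' + u' * v) by ring.
apply: (SD); first by apply: sumsetI; sr.
by apply: SD; exact: prod.
Qed.

End TClosureDelta.

(** * Conclusion for integral extensions *)

Lemma integral_power_integral (A : comNzRingType) (R U : set A) : is_subring R ->
  integral_extension R U -> power_integral R U.
Proof.
move=> hR int b Ub; have [p [pm /allP pR /eqP pb]] := int b Ub.
have Rp i : R p`_i.
  have [ip|pi] := ltnP i (size p); last by rewrite nth_default//; sr.
  by have := pR _ (mem_nth 0 ip); rewrite inE.
exists (size p).-1, (fun i => - p`_i) => [i|]; first by sr.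
have [n pn] : exists n, size p = n.+1.
  by exists (size p).-1; rewrite prednK// size_poly_gt0 monic_neq0.
move: (monicP pm) pb; rewrite horner_coef lead_coefE pn big_ord_recr /= => ->.
rewrite mul1r.
move=> /eqP; rewrite addrC addr_eq0 => /eqP ->.
by rewrite -sumrN; apply: eq_bigr => i _; rewrite mulNr.
Qed.

Theorem theorem4p11 (S : comNzRingType) (R : set S)
    (hR : is_subring R) (hRS : R `<` [set: S])
    (hint : integral_extension R [set: S])
    (hcat : catenarian R [set: S]) :
  (Delta_extension R [set: S] <->
     Delta_extension R (t_closure R [set: S]) /\
     Delta_extension (t_closure R [set: S]) [set: S]) /\
  (Delta_extension (t_closure R [set: S]) [set: S] <->
     arithmetic (t_closure R [set: S]) [set: S]).
Proof.
have int := integral_power_integral hR hint.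
have [[IT tT] Tmin] := t_closureP hR (subringT S) (@subsetT _ R).
set T := t_closure R [set: S] in IT tT Tmin *.
have [hT RT _] := IT.
(* By transitivity such an [X] is t-closed in [S], so the least such ring [T] lies in it. *)
have T_least X : interm R T X -> t_closed X T -> X = T.
  move=> [hX RX XT] tX; apply/seteqP; split=> //; apply: Tmin => //.
  exact: t_closed_trans tX tT.
split; split.
- move=> DRS; split=> U V [hU RU UT] [hV RV VT].
    have [||hUV RUV _] := DRS U V; [by split..|split=> //].
    exact: sumset_sub.
  have [||hUV RUV _] := DRS U V; [by split=> //; apply: subset_trans RT _..|].
  by split=> //; apply: subset_trans RU _; apply: sumsetl; sr.
- by move=> [DRT DTS]; exact: (Delta_glue hcat int IT tT T_least).
- exact: Delta_arithmetic (proj1 hcat) int RT tT.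
- exact: arithmetic_Delta.
Qed.
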